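(* Consider a sequence (indexed by $n\to\infty$) of seeded Erdős–Rényi pairs $\mathcal{G}(n,m,\bm p)$, where $m$ and $\bm p$ may depend on $n$, and assume that for some $p,s\in[0,1]$ (depending on $n$) $$p_{11}=ps^2,\quad p_{10}=p_{01}=ps(1-s),\quad p_{00}=1-2ps+ps^2,$$ with $$1-p=\Theta(1)\quad\text{and}\quad s=\Omega\!\left(\frac{(\log n)^2}{\sqrt n}\right).$$ Achievability: If $(n+m)p_{11}-\log n\to+\infty$, then the MAP estimator achieves exact alignment with high probability, i.e. its error probability tends to $0$ as $n\to\infty$. Converse: If $\log n-(n+m)p_{11}\to+\infty$, then for any estimator the probability of error is bounded away from zero, i.e. for any sequence of estimators the $\liminf_{n\to\infty}$ of the error probability is $>0$.
   Context: Seeded Erdős–Rényi pair $\mathcal{G}(n,m,\bm p)$: two random graphs $G_1,G_2$ on a common set of $n+m$ vertices, generated so that, independently over all unordered pairs $e$ of distinct vertices, $\mathsf P((G_1(e),G_2(e))=(a,b))=p_{ab}$ for $a,b\in\{0,1\}$, where $\bm p=(p_{11},p_{10},p_{01},p_{00})$ is a probability vector and $G_k(e)\in\{0,1\}$ indicates whether $e$ is an edge of $G_k$. Standing assumption: $G_1(e)$ and $G_2(e)$ are positively correlated (correlation coefficient defined and $>0$). The anonymized graph $G_2'$ is obtained by relabeling the vertices of $G_2$ by a uniformly random permutation $\Pi^*$ independent of $(G_1,G_2)$. In addition to $G_1$ and $G_2'$, one is given the true alignment (the values of $\Pi^*$) on a fixed (deterministic) set $\mathcal V_s$ of $m$ vertices,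 called seeds; thus only the correspondence of the remaining $n$ vertices is unknown. An estimator is a function of the observed data ($G_1$, $G_2'$, and the seed alignment) with values in permutations; its error probability is the probability that it differs from $\Pi^*$. The MAP estimator is a maximizer of the posterior probability of $\Pi^*$ given the observed data. $f=O(g)$ means $\limsup_{n\to\infty}|f(n)|/g(n)<\infty$; $f=\Omega(g)$ means $\liminf_{n\to\infty}|f(n)|/g(n)>0$; $f=\Theta(g)$ means both. *)

(* Defs.v *)
From mathcomp Require Import all_boot all_order all_algebra all_fingroup.
From mathcomp Require Import all_classical all_reals all_analysis.
Set Implicit Arguments.
Unset Strict Implicit.
Unset Printing Implicit Defensive.
Import Order.TTheory GRing.Theory Num.Theory.
Import numFieldNormedType.Exports.
Local Open Scope ring_scope.

(* The sample space of the model is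
   finite, so its law is given by a probability mass function and probabilities
   are finite sums. *)

Section LandauSequences.
Variable R : realType.
Implicit Types f g : nat -> R.

Definition isBigO f g : Prop :=
  (limn_esup (fun n => (`|f n| / g n)%:E) < +oo)%E.

Definition isBigOmega f g : Prop :=
  (0 < limn_einf (fun n => (`|f n| / g n)%:E))%E.

Definition isBigTheta f g : Prop := isBigO f g /\ isBigOmega f g.

End LandauSequences.

(* Laws of a pair of {0,1}-valued variables: q a b is the mass p_{ab}, with
   true for 1 and false for 0. *)
Section BoolPair.
Variable R : realType.
Implicit Types (q : bool -> bool -> R) (f g : bool -> bool -> R).

Definition prob_vector q : Prop :=
  (forall a b, 0 <= q a b) /\ \sum_a \sum_b q a b = 1.

Definition expect2 q f : R := \sum_a \sum_b q a b * f a b.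

Definition cov2 q f g : R :=
  expect2 q (fun a b => f a b * g a b) - expect2 q f * expect2 q g.

Definition var2 q f : R := cov2 q f f.

Definition fst_ind (a b : bool) : R := a%:R.
Definition snd_ind (a b : bool) : R := b%:R.

Definition correlation q : R :=
  cov2 q fst_ind snd_ind
    / (Num.sqrt (var2 q fst_ind) * Num.sqrt (var2 q snd_ind)).

(* The first two conjuncts say that the coefficient is defined (the library's
   division by 0 is total). *)
Definition positively_correlated q : Prop :=
  [/\ 0 < var2 q fst_ind, 0 < var2 q snd_ind & 0 < correlation q].

End BoolPair.

Section Graphs.
Variable N : nat.

(* Unordered pairs of distinct vertices. *)
Definition edge : finType := {e : {set 'I_N} | #|e| == 2%N}.

(* A graph is the family of its edge indicators. *)
Definition graph : finType := {ffun edge -> bool}.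

Lemma edge_perm_subproof (pi : 'S_N) (e : edge) :
  #|[set pi x | x in val e]| == 2%N.
Proof. by rewrite card_imset ?(valP e) //; exact: perm_inj. Qed.

Definition edge_perm (pi : 'S_N) (e : edge) : edge :=
  Sub [set pi x | x in val e] (edge_perm_subproof pi e).

(* Vertex v of G becomes vertex pi v, so that
   relabel pi G {pi u, pi v} = G {u, v}. *)
Definition relabel (pi : 'S_N) (G : graph) : graph :=
  [ffun e => G (edge_perm pi^-1%g e)].

End Graphs.

Section SeededPair.
Variables (R : realType) (N : nat).
Implicit Types (q : bool -> bool -> R) (V : {set 'I_N}).

(* Outcomes (G_1, G_2, Pi). *)
Definition outcome : finType := (graph N * graph N * 'S_N)%type.

Definition mass q (w : outcome) : R :=
  let: (G1, G2, _) := w in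
  (\prod_(e : edge N) q (G1 e) (G2 e)) * (#|'S_N|%:R)^-1.

Definition Pr q (A : pred outcome) : R := \sum_(w | A w) mass q w.

(* (G_1, anonymized G_2, alignment revealed on the seeds). *)
Definition data : finType :=
  (graph N * graph N * {ffun 'I_N -> option 'I_N})%type.

Definition seed_alignment V (pi : 'S_N) : {ffun 'I_N -> option 'I_N} :=
  [ffun v => if v \in V then Some (pi v) else None].

Definition observe V (w : outcome) : data :=
  let: (G1, G2, pi) := w in (G1, relabel pi G2, seed_alignment V pi).

Definition estimator : Type := data -> 'S_N.

Definition error_prob q V (h : estimator) : R :=
  Pr q (fun w => h (observe V w) != w.2).

(* Equal to 0 on data of probability 0, so is_MAP leaves the estimator
   unconstrained there. *)
Definition posterior q V (d : data) (pi : 'S_N) : R :=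
  Pr q (fun w => (w.2 == pi) && (observe V w == d))
    / Pr q (fun w => observe V w == d).

Definition is_MAP q V (h : estimator) : Prop :=
  forall (d : data) (pi : 'S_N), posterior q V d pi <= posterior q V d (h d).

End SeededPair.

(* Main.v *)
Require Import Defs.
From mathcomp Require Import all_boot all_order all_algebra all_fingroup.
From mathcomp Require Import all_classical all_reals all_analysis.
From mathcomp Require Import ring lra zify.
Set Implicit Arguments.
Unset Strict Implicit.
Unset Printing Implicit Defensive.
Import Order.TTheory GRing.Theory Num.Theory.
Import numFieldNormedType.Exports.
Local Open Scope ring_scope.

(* Write N = n + m, P = p_11 and L = log n.  The MAP estimator can only err when
   some tau <> 1 fixing the seeds makes the agreement sum_e G1(e) G2(tau e) at
   least as large as for tau = 1.  For one tau, moving k vertices and t edges,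
   the moment generating function of the difference of agreements is a product,
   over the cycles of tau on edges, of traces of powers of a 2 x 2 transfer
   matrix of trace 1; this gives a bound exp(- t det).

   If N P >= C L with C large, a union bound over tau suffices.  If L <= N P <=
   C L, then p = O(1 / L^3) by the assumption on s, so det = P (1 - O(1 / L)),
   and the union bound still works for k P bounded, where t = k N - O(k / P).
   For larger k it fails, because t may be only k N / 2; there one first
   discards, by a union bound over supports (2^n of them, instead of n^k
   permutations), the event that few common edges touch the support.  Otherwise
   tau must create at least k L / 32 coincidences G1(e) G2(tau e) out of
   independent edges, each of probability p P, which is very unlikely since p
   tends to 0.

   For the converse, a second moment computation gives two non-seed vertices
   isolated in the intersection graph; swapping them yields an equally observed
   and at least as likely outcome, so that any estimator errs with at least half
   the probability of this event. *)

(** * Expectation over a pair of graphs; products along a permutation *)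

Section PairExpectation.
Variables (R : realType) (E : finType).
Implicit Types (q : bool -> bool -> R) (a b : {ffun E -> bool}).
Implicit Types (f g : {ffun E -> bool} -> {ffun E -> bool} -> R).

Definition pairE q f : R :=
  \sum_(a : {ffun E -> bool}) \sum_(b : {ffun E -> bool})
    (\prod_e q (a e) (b e)) * f a b.

Lemma pairE_le q f g : (forall u v, 0 <= q u v) ->
  (forall a b, f a b <= g a b) -> pairE q f <= pairE q g.
Proof.
move=> q0 fg; apply: ler_sum => a _; apply: ler_sum => b _.
by apply: ler_wpM2l => //; apply: prodr_ge0.
Qed.

Lemma pairE_ge0 q f : (forall u v, 0 <= q u v) ->
  (forall a b, 0 <= f a b) -> 0 <= pairE q f.
Proof.
move=> q0 f0; apply: sumr_ge0 => a _; apply: sumr_ge0 => b _.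
by apply: mulr_ge0 => //; apply: prodr_ge0.
Qed.

Lemma pairE_sum q (I : finType) (P : pred I) (F : I -> _) :
  pairE q (fun a b => \sum_(i | P i) F i a b) = \sum_(i | P i) pairE q (F i).
Proof.
rewrite /pairE [RHS]exchange_big /=; apply: eq_bigr => a _.
rewrite [RHS]exchange_big /=; apply: eq_bigr => b _.
by rewrite mulr_sumr.
Qed.

Lemma pairEZ q (x : R) f :
  pairE q (fun a b => x * f a b) = x * pairE q f.
Proof.
rewrite /pairE mulr_sumr; apply: eq_bigr => a _.
by rewrite mulr_sumr; apply: eq_bigr => b _; rewrite mulrCA.
Qed.

Lemma pairED q f g :
  pairE q (fun a b => f a b + g a b) = pairE q f + pairE q g.
Proof.
rewrite /pairE -big_split; apply: eq_bigr => a _.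
by rewrite -big_split; apply: eq_bigr => b _; rewrite mulrDr.
Qed.

Lemma eq_pairE q f g : (forall a b, f a b = g a b) -> pairE q f = pairE q g.
Proof.
by move=> fg; apply: eq_bigr => a _; apply: eq_bigr => b _; rewrite fg.
Qed.

Lemma pairE_prod q (phi : E -> bool -> bool -> R) :
  pairE q (fun a b => \prod_e phi e (a e) (b e)) =
  \prod_e \sum_u \sum_v q u v * phi e u v.
Proof.
rewrite /pairE bigA_distr_bigA; apply: eq_bigr => a _.
rewrite bigA_distr_bigA; apply: eq_bigr => b _.
by rewrite -big_split.
Qed.

Lemma pairE1 q : \sum_u \sum_v q u v = 1 -> pairE q (fun _ _ => 1) = 1.
Proof.
move=> q1; have := @pairE_prod q (fun _ _ _ => 1).
rewrite [RHS]big1 => [pE|e _]; last first.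
  by rewrite -[RHS]q1; apply: eq_bigr => u _; apply: eq_bigr => v _; rewrite mulr1.
by rewrite -[RHS]pE; apply: eq_pairE => a b; rewrite big1.
Qed.

End PairExpectation.

Section CyclicProducts.
Variables (R : realType) (E : finType).
Implicit Types (sigma : {perm E}) (f : E -> bool -> bool -> R).

Let Z sigma f : R := \sum_(b : {ffun E -> bool}) \prod_e f e (b e) (b (sigma e)).

Let flip (e0 : E) (b : {ffun E -> bool}) : {ffun E -> bool} :=
  [ffun e => if e == e0 then ~~ b e else b e].

Let flipK e0 : involutive (flip e0).
Proof.
by move=> b; apply/ffunP => e; rewrite !ffunE; case: eqP => // _; rewrite negbK.
Qed.

(** Averaging over the flip of one coordinate replaces summing that coordinate out, so that the
    index set of functions on [E] stays the same through the induction. *)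
Let sum_flip e0 (F : {ffun E -> bool} -> R) :
  \sum_b F b = \sum_b 2^-1 * (F b + F (flip e0 b)).
Proof.
rewrite -mulr_sumr big_split /=.
have -> : \sum_b F (flip e0 b) = \sum_b F b.
  by rewrite [RHS](reindex_inj (inv_inj (flipK e0))).
by field.
Qed.

Definition hs_norm2 (M : bool -> bool -> R) := \sum_u \sum_v M u v ^+ 2.
Definition btrace (M : bool -> bool -> R) := \sum_u M u u.
Definition bmul (M M' : bool -> bool -> R) u w := \sum_v M u v * M' v w.

Lemma big_boolE (F : bool -> R) : \sum_u F u = F true + F false.
Proof. by rewrite big_bool. Qed.

Lemma hs_norm2_ge0 M : 0 <= hs_norm2 M.
Proof. by apply: sumr_ge0 => u _; apply: sumr_ge0 => v _; apply: sqr_ge0. Qed.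

Let cs2 (x y z w : R) : (x * y + z * w) ^+ 2 <= (x ^+ 2 + z ^+ 2) * (y ^+ 2 + w ^+ 2).
Proof. by have := sqr_ge0 (x * w - z * y); rewrite !expr2; nra. Qed.

Lemma hs_norm2_bmul M M' : hs_norm2 (bmul M M') <= hs_norm2 M * hs_norm2 M'.
Proof.
rewrite /hs_norm2 /bmul !big_boolE /=.
move: (cs2 (M true true) (M' true true) (M true false) (M' false true)).
move: (cs2 (M true true) (M' true false) (M true false) (M' false false)).
move: (cs2 (M false true) (M' true true) (M false false) (M' false true)).
move: (cs2 (M false true) (M' true false) (M false false) (M' false false)).
set A := (_ * _ + _ * _) ^+ 2; set B := (_ * _ + _ * _) ^+ 2.
set C := (_ * _ + _ * _) ^+ 2; set D := (_ * _ + _ * _) ^+ 2.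
lra.
Qed.

(** Cauchy-Schwarz on the four entries; the six squares given to [nra] are those of Lagrange's
    identity. *)
Lemma btrace_bmul M M' : btrace (bmul M M') ^+ 2 <= hs_norm2 M * hs_norm2 M'.
Proof.
rewrite /hs_norm2 /bmul /btrace !big_boolE /=.
set a := M _ _; set b := M' _ _; set c := M _ _; set d := M' _ _.
set a' := M _ _; set b' := M' _ _; set c' := M _ _; set d' := M' _ _.
have := sqr_ge0 (a * d - c * b); have := sqr_ge0 (a * b' - a' * b).
have := sqr_ge0 (a * d' - c' * b); have := sqr_ge0 (c * b' - a' * d).
have := sqr_ge0 (c * d' - c' * d); have := sqr_ge0 (a' * d' - c' * b').
by rewrite !expr2; nra.
Qed.

Let bound sigma f : R :=
  \prod_e (if sigma e == e then btrace (f e) ^+ 2 else hs_norm2 (f e)).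

(* Summing over the value at a moved point [e0] contracts the two factors that
   involve it into a matrix product and bypasses [e0] in its cycle. *)
Lemma cyclic_prod_bound sigma f : (forall e u v, 0 <= f e u v) ->
  (\sum_(b : {ffun E -> bool}) \prod_e f e (b e) (b (sigma e))) ^+ 2 <=
  \prod_e (if sigma e == e then btrace (f e) ^+ 2 else hs_norm2 (f e)).
Proof.
rewrite -/(Z sigma f) -/(bound sigma f).
have [n] := ubnP #|[pred e | sigma e != e]|.
elim: n sigma f => // n IHn sigma f; rewrite ltnS => sn f0.
have [/existsP[e0 /= e0m]|] := boolP [exists e, sigma e != e]; last first.
  rewrite negb_exists => /forallP /= fixed.
  have sE e : sigma e = e by apply/eqP/negPn/fixed.
  have -> : Z sigma f = \prod_e \sum_u f e u u.
    rewrite bigA_distr_bigA; apply: eq_bigr => b _.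
    by apply: eq_bigr => e _; rewrite sE.
  rewrite /bound -prodrXl.
  by rewrite le_eqVlt; apply/orP; left; apply/eqP/eq_bigr => e _; rewrite sE eqxx.
pose e1 := (sigma^-1)%g e0.
have se1 : sigma e1 = e0 by rewrite /e1 permKV.
have e10 : e1 != e0 by apply: contra e0m => /eqP e1E; rewrite -{1}e1E se1.
pose s' : {perm E} := (sigma * tperm e0 (sigma e0))%g.
have s'e0 : s' e0 = e0 by rewrite permM tpermR.
have s'e1 : s' e1 = sigma e0 by rewrite permM se1 tpermL.
have s'E e : e != e0 -> e != e1 -> s' e = sigma e.
  move=> ne0 ne1; rewrite permM tpermD //.
    by apply: contra ne1 => /eqP e0E; rewrite -(inj_eq (@perm_inj _ sigma)) se1 e0E.
  by apply: contra ne0 => /eqP /perm_inj ->.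
(* The constant matrix 1/2 at the new fixed point [e0] absorbs the factor 1/2 of [sum_flip]; its
   trace is 1, so [e0] drops out of the bound. *)
pose f' e := if e == e0 then fun _ _ => 2^-1
             else if e == e1 then bmul (f e1) (f e0) else f e.
have f'0 e u v : 0 <= f' e u v.
  rewrite /f'; case: ifP => _; first by rewrite invr_ge0 ler0n.
  by case: ifP => _ //; apply: sumr_ge0 => w _; apply: mulr_ge0.
have ZE : Z sigma f = Z s' f'.
  rewrite /Z (sum_flip e0); apply: eq_bigr => b _.
  rewrite [in RHS](bigD1 e0) //= [in RHS](bigD1 e1) //=.
  rewrite !(bigD1 (P := predT) e0) //= !(bigD1 (P := fun i => i != e0) e1) //=.
  have -> : \prod_(i | (i != e0) && (i != e1)) f i (flip e0 b i) (flip e0 b (sigma i))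
     = \prod_(i | (i != e0) && (i != e1)) f i (b i) (b (sigma i)).
    apply: eq_bigr => e /andP[ne0 ne1]; rewrite !ffunE (negPf ne0).
    by rewrite -[X in sigma e == X]se1 (inj_eq (@perm_inj _ sigma)) (negPf ne1).
  have -> : \prod_(i | (i != e0) && (i != e1)) f' i (b i) (b (s' i))
     = \prod_(i | (i != e0) && (i != e1)) f i (b i) (b (sigma i)).
    apply: eq_bigr => e /andP[ne0 ne1].
    by rewrite /f' (negPf ne0) (negPf ne1) s'E.
  rewrite {1 2}/f' eqxx (negPf e10) eqxx s'e1 se1 /bmul big_boolE.
  rewrite !ffunE !eqxx (negPf e0m) ?(negPf e10).
  by case: (b e0) => /=; ring.
rewrite ZE; apply: le_trans (IHn s' f' _ f'0) _.
  apply: leq_trans sn; apply: proper_card; apply/properP; split.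
    apply/fintype.subsetP => e; rewrite !inE.
    have [->|ne0] := eqVneq e e0; first by rewrite s'e0 eqxx.
    have [->|ne1] := eqVneq e e1; first by rewrite se1 [e0 == _]eq_sym e10.
    by rewrite s'E.
  by exists e0; rewrite !inE ?s'e0 ?eqxx.
rewrite /bound !(bigD1 (P := predT) e0) //= !(bigD1 (P := fun i => i != e0) e1) //=.
rewrite s'e0 eqxx {1}/f' eqxx se1 (negPf e0m) (eq_sym e0) (negPf e10).
rewrite [X in X ^+ 2](_ : _ = 1); last by rewrite /btrace big_boolE; field.
rewrite expr1n mul1r mulrA.
have -> : \prod_(i | (i != e0) && (i != e1))
    (if s' i == i then btrace (f' i) ^+ 2 else hs_norm2 (f' i)) =
  \prod_(i | (i != e0) && (i != e1))
    (if sigma i == i then btrace (f i) ^+ 2 else hs_norm2 (f i)).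
  apply: eq_bigr => e /andP[ne0 ne1].
  by rewrite /f' (negPf ne0) (negPf ne1) s'E.
apply: ler_wpM2r.
  by apply: prodr_ge0 => e _; case: ifP => _; rewrite ?sqr_ge0 ?hs_norm2_ge0.
rewrite /f' (negPf e10) eqxx [leRHS]mulrC.
(* If [e0] and [e1] formed a 2-cycle, [e1] has become a fixed point and the trace of the product is
   to be bounded; otherwise its norm is. *)
by case: ifP => _; [exact: btrace_bmul | exact: hs_norm2_bmul].
Qed.

End CyclicProducts.

(** * Generating functions and exponential tail bounds for agreements *)

Section GeneratingFunctions.
Variables (R : realType) (E : finType) (q : bool -> bool -> R).
Hypothesis q_ge0 : forall u v, 0 <= q u v.
Hypothesis q_sum1 : \sum_u \sum_v q u v = 1.
Implicit Types (sigma : {perm E}) (a b : {ffun E -> bool}) (w : bool -> bool -> bool -> R).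

Definition moved sigma : pred E := [pred e | sigma e != e].

(* The bound is (tr M^2)^t: rescaling by [om] makes M symmetric without changing
   the cyclic products, and then tr M^2 is its squared Hilbert-Schmidt norm. *)
Lemma moved_gf_bound sigma w (M : bool -> bool -> R) :
  (forall u v v', 0 <= w u v v') ->
  (forall v v', M v v' = \sum_u q u v * w u v v') ->
  0 < M true false -> 0 < M false true ->
  pairE q (fun a b => \prod_(e | sigma e != e) w (a e) (b e) (b (sigma e))) ^+ 2
  <= (M true true ^+ 2 + M false false ^+ 2
      + 2 * (M true false * M false true)) ^+ #|moved sigma|.
Proof.
move=> w0 ME Mtf Mft.
pose om (v : bool) := if v then Num.sqrt (M true false / M false true) else 1.
have om0 v : 0 < om v by rewrite /om; case: v => //; rewrite sqrtr_gt0 divr_gt0.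
have omN v : om v != 0 by rewrite gt_eqF.
(* At a fixed point the matrix entry is the marginal law of the second indicator; the trace is then
   1, so only moved points count. *)
pose f e v v' := (if sigma e == e then \sum_u q u v else M v v') * (om v' / om v).
have M0 v v' : 0 <= M v v'.
  by rewrite ME; apply: sumr_ge0 => u _; apply: mulr_ge0.
have f0 e v v' : 0 <= f e v v'.
  apply: mulr_ge0; last by apply: ltW; apply: divr_gt0.
  by case: ifP => _ //; apply: sumr_ge0.
have -> : pairE q (fun a b => \prod_(e | sigma e != e) w (a e) (b e) (b (sigma e)))
   = \sum_(b : {ffun E -> bool}) \prod_e f e (b e) (b (sigma e)).
  rewrite /pairE exchange_big; apply: eq_bigr => b _ /=.
  have -> : \prod_e f e (b e) (b (sigma e)) =
     \prod_e \sum_u (q u (b e) * if sigma e == e then 1 else w u (b e) (b (sigma e))).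
    rewrite /f big_split /=.
    have -> : \prod_e (om (b (sigma e)) / om (b e)) = 1.
      have -> : \prod_e (om (b (sigma e)) / om (b e)) =
          (\prod_e om (b (sigma e))) / (\prod_e om (b e)) by rewrite prodf_div.
      have <- : \prod_e om (b e) = \prod_e om (b (sigma e)).
        by rewrite [LHS](reindex_perm sigma).
      by rewrite divff //; apply/prodf_neq0 => e _.
    rewrite mulr1; apply: eq_bigr => e _; case: ifP => _ //.
    by apply: eq_bigr => u _; rewrite mulr1.
  rewrite bigA_distr_bigA; apply: eq_bigr => a _.
  rewrite big_split /=; congr (_ * _).
  by rewrite big_mkcond; apply: eq_bigr => e _; case: eqP.
apply: le_trans (cyclic_prod_bound sigma f0) _.
rewrite (bigID (moved sigma)) /= [X in _ * X]big1 ?mulr1; last first.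
  move=> e; rewrite negbK => /eqP sE; rewrite sE eqxx /btrace.
  rewrite -[RHS](expr1n _ 2); congr (_ ^+ 2).
  rewrite -q_sum1 [RHS]exchange_big /=; apply: eq_bigr => v _.
  by rewrite /f sE eqxx divff // mulr1.
rewrite (eq_bigr (fun=> M true true ^+ 2 + M false false ^+ 2
      + 2 * (M true false * M false true))) ?prodr_const //.
move=> e sE; rewrite (negPf sE) /hs_norm2 /f (negPf sE) !big_boolE /=.
rewrite /om /=; set r := Num.sqrt _.
have rN : r != 0 by rewrite gt_eqF // sqrtr_gt0 divr_gt0.
have r2 : r ^+ 2 = M true false / M false true by rewrite sqr_sqrtr ?divr_ge0.
transitivity (M true true ^+ 2 + M true false ^+ 2 / r ^+ 2
              + M false true ^+ 2 * r ^+ 2 + M false false ^+ 2).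
  by field.
by rewrite r2; field; rewrite !gt_eqF.
Qed.

Definition agreement sigma a b : nat := \sum_e (a e && b (sigma e)).

Definition moved_agreement sigma a b : nat :=
  \sum_(e | sigma e != e) (a e && b (sigma e)).

Lemma prodrX_nat (x : R) (P : pred E) (F : E -> bool) :
  \prod_(e | P e) x ^+ F e = x ^+ (\sum_(e | P e) F e).
Proof. by elim/big_rec2: _ => // e m y _ ->; rewrite exprD. Qed.

Lemma sqr_pow_le_expR (Z v : R) t : 0 <= Z ->
  Z ^+ 2 <= (1 + 2 * v) ^+ t -> 0 <= 1 + 2 * v -> Z <= expR (t%:R * v).
Proof.
move=> Z0 Zv v0; rewrite -(@ler_pXn2r _ 2) ?nnegrE ?expR_ge0 //.
apply: le_trans Zv _.
have -> : expR (t%:R * v) ^+ 2 = expR (2 * v) ^+ t.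
  by rewrite -!expRM_natl; congr expR; ring.
by apply: lerXn2r; rewrite ?nnegrE ?expR_ge0 // expR_ge1Dx.
Qed.

(* The factor of #|moved sigma| is the determinant of a transfer matrix M with
   tr M = 1, whence tr M^2 = 1 - 2 det M. *)
Lemma agreement_tail sigma (x : R) : 1 <= x ->
  0 < q true true -> 0 < q false false ->
  pairE q (fun a b => (agreement 1 a b <= agreement sigma a b)%N%:R)
  <= expR (- (#|moved sigma|%:R *
    ((x - 1) * (q true true * q false false / x - q true false * q false true)))).
Proof.
move=> x1 q11 q00; have x0 : 0 < x by exact: lt_le_trans x1.
have xN : x != 0 by rewrite gt_eqF.
(* Exponential Markov inequality: the product of [w] over the moved edges is [x] to the power of the
   gain in agreement, written as a quotient because the gain may be negative. *)
pose w (u v v' : bool) := x ^+ (u && v') / x ^+ (u && v).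
pose M v v' := \sum_u q u v * w u v v'.
have w0 u v v' : 0 <= w u v v' by rewrite divr_ge0 ?exprn_ge0 // ltW.
set det := (x - 1) * _.
have q00E : q false false = 1 - q true true - q true false - q false true.
  by move: q_sum1; rewrite !big_boolE => <-; ring.
have Mtf : 0 < M true false.
  rewrite /M /w big_boolE /= expr0 expr1 divr1.
  by rewrite ltr_pwDl ?mulr_ge0 // mulr_gt0 // mul1r invr_gt0.
have Mft : 0 < M false true.
  rewrite /M /w big_boolE /= expr0 expr1 !divr1 mulr1.
  by rewrite ltr_wpDl ?mulr_ge0 // ltW.
have trM : M true true ^+ 2 + M false false ^+ 2
      + 2 * (M true false * M false true) = 1 + 2 * (- det).
  rewrite /M /w !big_boolE /= !expr0 !expr1 /det q00E; by field.
rewrite -mulrN; apply: le_trans (_ : pairE q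
   (fun a b => \prod_(e | sigma e != e) w (a e) (b e) (b (sigma e))) <= _).
  apply: pairE_le => // a b.
  have -> : \prod_(e | sigma e != e) w (a e) (b e) (b (sigma e)) =
    x ^+ agreement sigma a b / x ^+ agreement 1 a b.
    rewrite -!prodrX_nat -prodf_div [RHS](bigID (moved sigma)) /=.
    rewrite [X in _ * X]big1 ?mulr1.
      by apply: eq_bigr => e _; rewrite /w perm1.
    by move=> e; rewrite negbK perm1 => /eqP ->; rewrite divff // expf_neq0.
  case: leqP => [le|_]; last by rewrite divr_ge0 // exprn_ge0 // ltW.
  by rewrite ler_pdivlMr ?exprn_gt0 // mul1r ler_weXn2l.
apply: sqr_pow_le_expR.
- by apply: pairE_ge0 => // a b; apply: prodr_ge0.
- by rewrite -trM; apply: moved_gf_bound.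
- rewrite -trM addr_ge0 ?addr_ge0 ?sqr_ge0 ?mulr_ge0 ?ltW //; lra.
Qed.

(** Exponential Markov inequality with weight [expR theta] per coincidence. For a moved edge, [a e]
    and [b (sigma e)] are independent, whence the product of the two marginals in the exponent; the
    squared term is a second-order cost of the dependence along cycles. *)
Lemma moved_agreement_tail sigma (theta r : R) : 0 <= theta ->
  0 < q true true -> 0 < q false false ->
  pairE q (fun a b => (r <= (moved_agreement sigma a b)%:R)%R%:R)
  <= expR (- (theta * r)) * expR (#|moved sigma|%:R *
    ((expR theta - 1) * ((q true true + q true false) * (q true true + q false true))
     + ((expR theta - 1) * q true true) ^+ 2 / 2)).
Proof.
move=> th0 q11 q00; set y := expR theta.
have y0 : 0 < y by exact: expR_gt0.
pose w (u v v' : bool) := y ^+ (u && v').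
pose M v v' := \sum_u q u v * w u v v'.
have w0 u v v' : 0 <= w u v v' by rewrite exprn_ge0 // ltW.
set v := _ + _ / 2.
have q00E : q false false = 1 - q true true - q true false - q false true.
  by move: q_sum1; rewrite !big_boolE => <-; ring.
have Mtf : 0 < M true false.
  by rewrite /M /w big_boolE /= expr0 !mulr1 ltr_pwDl.
have Mft : 0 < M false true.
  rewrite /M /w big_boolE /= expr0 expr1 !mulr1.
  by rewrite ltr_wpDl ?mulr_ge0 // ltW.
have trM : M true true ^+ 2 + M false false ^+ 2
      + 2 * (M true false * M false true) = 1 + 2 * v.
  rewrite /M /w !big_boolE /= !expr0 !expr1 /v q00E; by field.
apply: le_trans (_ : expR (- (theta * r)) * pairE q
   (fun a b => \prod_(e | sigma e != e) w (a e) (b e) (b (sigma e))) <= _).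
  rewrite -pairEZ; apply: pairE_le => // a b.
  rewrite prodrX_nat -/(moved_agreement sigma a b) /y -expRM_natl -expRD.
  have [le|_] := boolP (r <= _); last by rewrite expR_ge0.
  rewrite -[leLHS]expR0 ler_expR addrC -[_ * theta]mulrC -mulrBr.
  by rewrite mulr_ge0 // subr_ge0.
apply: ler_wpM2l; first exact: expR_ge0.
apply: sqr_pow_le_expR.
- by apply: pairE_ge0 => // a b; apply: prodr_ge0.
- by rewrite -trM; apply: moved_gf_bound.
- rewrite -trM addr_ge0 ?addr_ge0 ?sqr_ge0 ?mulr_ge0 ?ltW //; lra.
Qed.

(** The count of common edges in [S] is binomial. The value [z = expR (- 1)] serves for its lower
    tail in the achievability part, and [z = 0] for the probability of no common edge in the
    converse. *)
Lemma common_edges_gf (S : {pred E}) (z : R) :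
  pairE q (fun a b => z ^+ (\sum_(e in S) (a e && b e))) =
  (1 - (1 - z) * q true true) ^+ #|S|.
Proof.
transitivity (pairE q (fun a b =>
    \prod_e (if e \in S then z ^+ (a e && b e) else 1))).
  by apply: eq_pairE => a b; rewrite -big_mkcond prodrX_nat.
rewrite (pairE_prod q (fun e u v => if e \in S then z ^+ (u && v) else 1)).
rewrite (bigID (mem S)) /= [X in _ * X]big1 ?mulr1; last first.
  move=> e /negPf ->; rewrite -[RHS]q_sum1.
  by apply: eq_bigr => u _; apply: eq_bigr => v _; rewrite mulr1.
rewrite -prodr_const; apply: eq_bigr => e ->.
rewrite -[X in X - _]q_sum1 !big_boolE /= expr0 expr1; ring.
Qed.

End GeneratingFunctions.

(** * Action of vertex permutations on edges *)

Section EdgePermutations.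
Variable N : nat.
Implicit Types (S : {set 'I_N}) (tau : 'S_N) (e : edge N).

Definition touches S : simpl_pred (edge N) := [pred e : edge N | ~~ [disjoint val e & S]].

Lemma card_edges_in S : #|[pred e : edge N | val e \subset S]| = 'C(#|S|, 2).
Proof.
rewrite -cards_draws -(fintype.card_image (@val_inj _ _ (edge N))).
rewrite -[RHS]cardsE; apply: eq_card => A; rewrite !inE.
apply/fintype.imageP/andP => [[e eS ->]|[AS A2]]; first by rewrite (valP e).
by exists (Sub A A2); rewrite ?inE SubK.
Qed.

Lemma card_touches S : (#|touches S| + 'C(N - #|S|, 2) = 'C(N, 2))%N.
Proof.
have <- : #|~: S| = (N - #|S|)%N by rewrite cardsCs finset.setCK card_ord.
rewrite -[in RHS](card_ord N) -cardsT -!card_edges_in addnC.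
rewrite -[RHS](cardID [pred e : edge N | val e \subset ~: S]).
by congr (_ + _)%N; apply: eq_card => e;
  rewrite !inE finset.subsetT ?andbT ?finset.disjoints_subset.
Qed.

Lemma edge_perm_inj tau : injective (edge_perm tau).
Proof.
move=> e e' /(congr1 val) /= E; apply: val_inj.
by apply: imset_inj E; apply: perm_inj.
Qed.

Definition eperm tau : {perm edge N} := perm (@edge_perm_inj tau).

Lemma epermE tau e : eperm tau e = edge_perm tau e.
Proof. by rewrite permE. Qed.

Lemma edge_permM tau tau' e :
  edge_perm (tau * tau')%g e = edge_perm tau' (edge_perm tau e).
Proof.
apply: val_inj => /=; rewrite -imset_comp.
by apply: eq_imset => x; rewrite permM.
Qed.

Lemma edge_perm1 e : edge_perm 1%g e = e.
Proof.
apply: val_inj => /=; rewrite -[RHS]imset_id.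
by apply: eq_imset => x; rewrite perm1.
Qed.

Definition psupport tau : {set 'I_N} := [set x | tau x != x].

Lemma edge_perm_fix tau e : e \notin touches (psupport tau) -> edge_perm tau e = e.
Proof.
rewrite inE negbK => /pred0P dis; apply: val_inj => /=.
rewrite -[RHS]imset_id; apply: eq_in_imset => x xe.
by have := dis x; rewrite /= xe inE => /negbFE/eqP.
Qed.

(* A fixed edge meeting the support of [tau] is swapped: it is {u, tau u}. *)
Lemma card_touches_fixed tau :
  (#|[pred e in touches (psupport tau) | edge_perm tau e == e]| <= #|psupport tau|)%N.
Proof.
apply: leq_trans (leq_imset_card (fun u => [set u; tau u]) _).
rewrite -(fintype.card_image (@val_inj _ _ (edge N))).
apply: subset_leq_card; apply/fintype.subsetP => A /fintype.imageP[e].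
rewrite !inE => /andP[/pred0Pn[u /= /andP[ue]]]; rewrite inE => tu /eqP te ->.
apply/imsetP; exists u; rewrite ?inE //.
apply/esym/eqP; rewrite eqEcard (eqP (valP e)) cards2 eq_sym tu andbT.
apply/fintype.subsetP => x; rewrite !inE => /orP[] /eqP -> //.
by rewrite -te imset_f.
Qed.

Lemma card_moved_le tau : (#|moved (eperm tau)| <= #|touches (psupport tau)|)%N.
Proof.
apply: subset_leq_card; apply/fintype.subsetP => e.
by rewrite inE epermE; apply: contraNT => /edge_perm_fix ->.
Qed.

(** The additive loss bounds the touching edges that [tau] fixes, by [card_touches_fixed]. A general
    [F] covers both the count of common edges and, when constantly true, cardinalities. *)
Lemma touches_le_moved tau (F : edge N -> bool) :
  (\sum_(e in touches (psupport tau)) F e <=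
   \sum_(e in moved (eperm tau)) F e + #|psupport tau|)%N.
Proof.
rewrite (bigID (moved (eperm tau))) /=; apply: leq_add.
  rewrite [leqRHS]big_mkcond [leqLHS]big_mkcond; apply: leq_sum => e _.
  rewrite !inE; case: (~~ [disjoint _ & _]) => //=; case: (_ != _) => //=.
apply: leq_trans (card_touches_fixed tau); rewrite -sum1_card.
rewrite [leqRHS]big_mkcond [leqLHS]big_mkcond; apply: leq_sum => e _.
by rewrite !inE negbK epermE; case: ifP => // _; apply: leq_b1.
Qed.

Lemma card_touches_le_moved tau :
  (#|touches (psupport tau)| <= #|moved (eperm tau)| + #|psupport tau|)%N.
Proof. by have := touches_le_moved tau xpredT; rewrite !sum1_card. Qed.

Lemma card_support_gt0 tau : tau != 1%g -> (0 < #|psupport tau|)%N.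
Proof.
move=> t1; rewrite card_gt0; apply: contra t1 => /eqP s0.
apply/eqP/permP => x; rewrite perm1; apply/eqP.
by have : x \notin psupport tau; [rewrite s0 inE | rewrite inE negbK].
Qed.

Lemma card_touchesR (R : realType) S : (#|touches S|%:R : R) =
  #|S|%:R * (2 * N%:R - #|S|%:R - 1) / 2.
Proof.
have bin2R n : ('C(n, 2)%:R : R) = n%:R * (n%:R - 1) / 2.
  case: n => [|n]; first by rewrite bin0n mul0r mul0r.
  apply: (@mulIf _ 2); rewrite ?pnatr_eq0 // mulfVK ?pnatr_eq0 //.
  rewrite -[in LHS](_ : 2`! = 2)%N // -natrM bin_ffact ffactnS ffactn1 /= natrM.
  by rewrite -natr1 addrK.
have SN : (#|S| <= N)%N by rewrite -[leqRHS]card_ord max_card.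
have /(congr1 (fun n => n%:R : R)) := card_touches S.
rewrite natrD !bin2R natrB // => /eqP.
rewrite -subr_eq0 => /eqP E; apply/eqP; rewrite -subr_eq0 -E; apply/eqP; by field.
Qed.

End EdgePermutations.

(** * Counting permutations by the size of their support *)

Section PermutationSums.
Variables (R : realType) (N : nat) (U : {set 'I_N}).

(** Choosing a [k]-subset of [U] and then permuting it can be done in a falling factorial number of
    ways. *)
Lemma card_support_perm_on k :
  (#|[set tau : 'S_N | perm_on U tau && (#|psupport tau| == k)]| <= #|U| ^ k)%N.
Proof.
apply: leq_trans (_ : #|\bigcup_(A in [set A : {set 'I_N} | A \subset U & #|A| == k])
    [set tau : 'S_N | perm_on A tau]| <= _)%N.
  apply: subset_leq_card; apply/fintype.subsetP => tau; rewrite inE => /andP[tU tk].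
  apply/bigcupP; exists (psupport tau); last first.
    by rewrite inE; apply/fintype.subsetP => x; rewrite [x \in psupport _]inE.
  rewrite inE tk andbT; apply/fintype.subsetP => x; rewrite inE.
  by move/fintype.subsetP: tU; apply.
apply: leq_trans (_ : \sum_(A in [set A : {set 'I_N} | A \subset U & #|A| == k]) k`! <= _)%N.
  elim/big_rec2: _ => [|A n B]; first by rewrite cards0.
  rewrite inE => /andP[_ /eqP <-] le; apply: leq_trans (leq_card_setU _ _) _.
  by rewrite leq_add // cardsE card_perm.
rewrite sum_nat_const cards_draws bin_ffact.
elim: k => [|k IHk]; first by rewrite ffactn0.
rewrite ffactnSr expnSr; apply: leq_mul => //; exact: leq_subr.
Qed.

(** Grouped by support size, the sum is dominated by a geometric series of ratio [#|U| * x], at most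
    1/2; it starts at exponent 1 because the identity is excluded. *)
Lemma sum_perm_on (x : R) : 0 <= x -> #|U|%:R * x <= 1 / 2 ->
  \sum_(tau : 'S_N | perm_on U tau && (tau != 1%g)) x ^+ #|psupport tau|
  <= 2 * (#|U|%:R * x).
Proof.
move=> x0; set y := _ * x => y12.
have y0 : 0 <= y by rewrite mulr_ge0.
apply: le_trans (_ : \sum_(1 <= k < N.+1) y ^+ k <= _).
  rewrite (partition_big (fun tau : 'S_N => inord #|psupport tau| : 'I_N.+1)
            xpredT) //=.
  rewrite -(big_mkord xpredT (fun k => \sum_(tau : 'S_N | (perm_on U tau && (tau != 1%g))
       && ((inord #|psupport tau| : 'I_N.+1) == k :> nat)) x ^+ #|psupport tau|)).
  have sN (tau : 'S_N) : (#|psupport tau| < N.+1)%N.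
    by rewrite ltnS -[leqRHS](card_ord N) max_card.
  rewrite big_ltn // big1 ?add0r; last first.
    move=> tau /andP[/andP[_ /card_support_gt0 t1]]; rewrite inordK // => /eqP E.
    by rewrite E in t1.
  apply: ler_sum => k _.
  apply: le_trans (_ : \sum_(tau in [set tau : 'S_N | perm_on U tau && (#|psupport tau| == k)]) x ^+ k <= _).
    rewrite [leLHS]big_mkcond [leRHS]big_mkcond /=; apply: ler_sum => tau _.
    rewrite inE inordK //; case: perm_on => //=.
    have [->|_] := eqVneq #|psupport tau| k; last by rewrite andbF.
    rewrite andbT.
    by case: (tau != _) => //=; rewrite exprn_ge0.
  rewrite sumr_const -mulr_natl exprMn; apply: ler_wpM2r; first exact: exprn_ge0.
  by rewrite -natrX ler_nat card_support_perm_on.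
have -> : \sum_(1 <= k < N.+1) y ^+ k = y * \sum_(k < N) y ^+ k.
  rewrite big_add1 /= big_mkord mulr_sumr; apply: eq_bigr => k _; by rewrite exprS.
rewrite [leRHS]mulrC; apply: ler_wpM2l => //.
have y1 : 0 < 1 - y by lra.
rewrite -(ler_pM2l y1) -[1 - y]opprB mulNr -subrX1 opprB.
by have := exprn_ge0 N y0; lra.
Qed.

End PermutationSums.

(** * Likelihood and the MAP estimator *)

Section Likelihood.
Variables (R : realType) (E : finType) (q : bool -> bool -> R).
Hypothesis q_ge0 : forall u v, 0 <= q u v.
Implicit Types a b : {ffun E -> bool}.

Definition likelihood a b : R := \prod_e q (a e) (b e).

Lemma likelihoodE a b : likelihood a b =
  q true true ^+ (\sum_e (a e && b e)) * q true false ^+ (\sum_e (a e && ~~ b e))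
  * (q false true ^+ (\sum_e (~~ a e && b e))
     * q false false ^+ (\sum_e (~~ a e && ~~ b e))).
Proof.
rewrite /likelihood -!prodrX_nat -!big_split; apply: eq_bigr => e _ /=.
by case: (a e); case: (b e); rewrite /= !expr0 !expr1 ?mulr1 ?mul1r.
Qed.

(** When the edge counts are fixed, the agreement determines all four counts of edge types: [d] more
    agreements turn [d] pairs of types 10 and 01 into pairs of types 11 and 00. The common factor
    [L0] avoids dividing by entries of [q], which may vanish. *)
Lemma likelihood_factor a b b' : (\sum_e b e = \sum_e b' e)%N ->
  (\sum_e (a e && b e) <= \sum_e (a e && b' e))%N ->
  let d := (\sum_e (a e && b' e) - \sum_e (a e && b e))%N in
  exists2 L0, 0 <= L0 &
    likelihood a b = L0 * (q true false * q false true) ^+ d /\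
    likelihood a b' = L0 * (q true true * q false false) ^+ d.
Proof.
move=> bb' le d; rewrite !likelihoodE.
have aE (c : {ffun E -> bool}) :
    (\sum_e (a e && c e) + \sum_e (a e && ~~ c e) = \sum_e a e)%N.
  by rewrite -big_split; apply: eq_bigr => e _ /=; case: (a e); case: (c e).
have cE (c : {ffun E -> bool}) :
    (\sum_e (a e && c e) + \sum_e (~~ a e && c e) = \sum_e c e)%N.
  by rewrite -big_split; apply: eq_bigr => e _ /=; case: (a e); case: (c e).
have ncE (c : {ffun E -> bool}) :
    (\sum_e c e + \sum_e (~~ a e && ~~ c e) + \sum_e (a e && ~~ c e) = #|E|)%N.
  rewrite -sum1_card -!big_split; apply: eq_bigr => e _ /=.
  by case: (a e); case: (c e).
move: (aE b) (aE b') (cE b) (cE b') (ncE b) (ncE b') le; rewrite /d -bb'.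
set n11 := (\sum_e (a e && b e))%N; set n11' := (\sum_e (a e && b' e))%N.
set n10 := (\sum_e (a e && ~~ b e))%N; set n10' := (\sum_e (a e && ~~ b' e))%N.
set n01 := (\sum_e (~~ a e && b e))%N; set n01' := (\sum_e (~~ a e && b' e))%N.
set n00 := (\sum_e (~~ a e && ~~ b e))%N; set n00' := (\sum_e (~~ a e && ~~ b' e))%N.
move=> h1 h2 h3 h4 h5 h6 le; set k := (n11' - n11)%N.
have -> : n11' = (n11 + k)%N by rewrite /k; lia.
have -> : n10 = (n10' + k)%N by rewrite /k; lia.
have -> : n01 = (n01' + k)%N by rewrite /k; lia.
have -> : n00' = (n00 + k)%N by rewrite /k; lia.
exists (q true true ^+ n11 * q true false ^+ n10' * (q false true ^+ n01' * q false false ^+ n00)).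
  by rewrite !mulr_ge0 ?exprn_ge0.
by rewrite !exprMn !exprD; split; ring.
Qed.

Lemma likelihood_le a b b' : (\sum_e b e = \sum_e b' e)%N ->
  q true false * q false true <= q true true * q false false ->
  (\sum_e (a e && b e) <= \sum_e (a e && b' e))%N ->
  likelihood a b <= likelihood a b'.
Proof.
move=> bb' qq le; have [L0 L00 [-> ->]] := likelihood_factor bb' le.
by apply: ler_wpM2l => //; rewrite lerXn2r ?nnegrE ?mulr_ge0.
Qed.

Lemma likelihood_lt a b b' : (\sum_e b e = \sum_e b' e)%N ->
  q true false * q false true < q true true * q false false ->
  (\sum_e (a e && b e) < \sum_e (a e && b' e))%N ->
  0 < likelihood a b' -> likelihood a b < likelihood a b'.
Proof.
move=> bb' qq lt; have [L0 L00 [-> ->]] := likelihood_factor bb' (ltnW lt).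
rewrite le_eqVlt in L00; case/predU1P: L00 => [<-|L00]; first by rewrite mul0r ltxx.
rewrite !ltr_pM2l // => _; rewrite ltrXn2r ?nnegrE ?mulr_ge0 //.
by rewrite subn_eq0 -ltnNge.
Qed.

End Likelihood.

Section Estimation.
Variables (R : realType) (N : nat) (q : bool -> bool -> R) (V : {set 'I_N}).
Hypothesis q_ge0 : forall u v, 0 <= q u v.
Implicit Types (tau pi : 'S_N) (G : graph N) (w : outcome N).

(** This is [relabel] by the inverse of [tau], in the form that matches [agreement]. *)
Definition pull tau G : graph N := [ffun e => G (edge_perm tau e)].

Lemma sum_pull tau G : (\sum_e pull tau G e = \sum_e G e)%N.
Proof.
rewrite [RHS](reindex_perm (eperm tau)) /=.
by apply: eq_bigr => e _; rewrite ffunE epermE.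
Qed.

Lemma agreement_pull tau G1 G2 :
  (\sum_e (G1 e && pull tau G2 e) = agreement (eperm tau) G1 G2)%N.
Proof. by apply: eq_bigr => e _; rewrite ffunE epermE. Qed.

Lemma agreement1 G1 G2 : (\sum_e (G1 e && G2 e) = agreement 1 G1 G2)%N.
Proof. by apply: eq_bigr => e _; rewrite perm1. Qed.

(** Together with [observe_pull], this parametrizes the outcomes that share the observation of [w]
    by the permutations that fix the seeds. *)
Lemma observe_inv w w' : observe V w' = observe V w ->
  [/\ w'.1.1 = w.1.1, perm_on (~: V) (w'.2 * w.2^-1)%g
    & w'.1.2 = pull (w'.2 * w.2^-1)%g w.1.2].
Proof.
case: w w' => -[G1 G2] pi [[G1' G2'] pi'] /= [-> Erel Eseed]; split => //.
  apply/fintype.subsetP => x; rewrite !inE; apply: contra => xV.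
  have := congr1 (fun f : {ffun 'I_N -> option 'I_N} => f x) Eseed.
  by rewrite !ffunE xV permM => -[->]; rewrite permK.
apply/ffunP => e.
have := congr1 (fun G : graph N => G (edge_perm pi' e)) Erel.
by rewrite !ffunE -!edge_permM mulgV edge_perm1.
Qed.

Lemma observe_pull tau pi G1 G2 : perm_on (~: V) tau ->
  observe V (G1, pull tau G2, (tau * pi)%g) = observe V (G1, G2, pi).
Proof.
move=> tV; congr (_, _, _).
  by apply/ffunP => e; rewrite !ffunE -edge_permM invMg mulgKV.
apply/ffunP => x; rewrite !ffunE; case: ifPn => // xV.
by rewrite permM (out_perm tV) // inE xV.
Qed.

Lemma mass_ge0 w : 0 <= mass q w.
Proof.
by case: w => -[G1 G2] pi; rewrite mulr_ge0 ?invr_ge0 // prodr_ge0.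
Qed.

Lemma mass_likelihood w : mass q w = likelihood q w.1.1 w.1.2 / #|'S_N|%:R.
Proof. by case: w => -[]. Qed.

Lemma card_Sn_gt0 : 0 < #|'S_N|%:R :> R.
Proof. by rewrite ltr0n; apply/card_gt0P; exists 1%g. Qed.

Lemma sum_mass (f : graph N -> graph N -> R) :
  \sum_(w : outcome N) mass q w * f w.1.1 w.1.2 = pairE q f.
Proof.
transitivity (\sum_(g : graph N * graph N) likelihood q g.1 g.2 * f g.1 g.2).
  transitivity (\sum_(g : graph N * graph N) \sum_(pi : 'S_N)
      mass q (g, pi) * f g.1 g.2).
    by rewrite pair_bigA; apply: eq_bigr => -[].
  apply: eq_bigr => g _.
  rewrite (eq_bigr (fun=> likelihood q g.1 g.2 / #|'S_N|%:R * f g.1 g.2)) //; last first.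
    by move=> pi _; rewrite mass_likelihood.
  rewrite sumr_const -[LHS]mulr_natl.
  by rewrite mulrA mulrCA divff ?mulr1 // gt_eqF // card_Sn_gt0.
by rewrite /pairE pair_bigA; apply: eq_bigr => -[].
Qed.

(** A wrong MAP estimate comes from an outcome with the same data and at least the likelihood of the
    true one. Likelihood strictly increases with agreement, so the permutation relating the two
    alignments cannot lower the agreement. Ties count against the estimator. *)
Lemma MAP_error_le (h : estimator N) :
  q true false * q false true < q true true * q false false ->
  is_MAP q V h ->
  error_prob q V h <= pairE q (fun a b =>
    [exists tau : 'S_N, [&& perm_on (~: V) tau, tau != 1%g
       & (agreement 1 a b <= agreement (eperm tau) a b)%N]]%:R).
Proof.
move=> qq hM; rewrite -sum_mass /error_prob /Pr big_mkcond /=.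
apply: ler_sum => w _; have := mass_ge0 w.
case: ifPn => [err|_] w0; last by rewrite mulr_ge0.
rewrite le_eqVlt in w0; case/predU1P: w0 => [<-|w0]; first by rewrite mul0r.
set d := observe V w; set pi' := h d; rewrite -/d -/pi' in err.
(* Positive mass of [w] makes its data probable, so both posteriors are genuine quotients and
   compare through their numerators. *)
have D0 : 0 < Pr q (fun w' => observe V w' == d).
  rewrite /Pr (bigD1 w) //= ltr_pwDl //; apply: sumr_ge0 => w' _; exact: mass_ge0.
have := hM d w.2; rewrite /posterior ler_pM2r ?invr_gt0 // -/pi'.
have num_w : mass q w <= Pr q (fun w' => (w'.2 == w.2) && (observe V w' == d)).
  rewrite /Pr (bigD1 w) ?eqxx //= lerDl; apply: sumr_ge0 => w' _; exact: mass_ge0.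
move/(le_trans num_w) => num_le.
have /existsP[w' /andP[/eqP w'2 /eqP obsw']] :
    [exists w' : outcome N, (w'.2 == pi') && (observe V w' == d)].
  apply: contraTT num_le; rewrite negb_exists => /forallP none.
  by rewrite /Pr big1 -?ltNge // => w' w'P; have := none w'; rewrite w'P.
have [E1 tauV E2] := observe_inv obsw'.
(* Data and alignment determine the outcome, so this numerator is a sum over at most one outcome. *)
have num_w' : Pr q (fun w' => (w'.2 == pi') && (observe V w' == d)) <= mass q w'.
  have -> : mass q w' = \sum_(x | x == w') mass q x by rewrite big_pred1_eq.
  rewrite /Pr /= [leLHS]big_mkcond [leRHS]big_mkcond.
  apply: ler_sum => w'' _; case: ifP => [/andP[/eqP w''2 /eqP obsw'']|_]; last first.
    by case: ifP => // _; apply: mass_ge0.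
  have [E1' _ E2'] := observe_inv obsw''.
  case: eqP => // -[]; move: w''2 w'2 E1 E1' E2 E2'.
  case: w'' w' {obsw' tauV obsw''} => -[a b] c [[a' b'] c'] /= -> -> -> -> -> ->.
  by [].
have {num_le num_w'} := le_trans num_le num_w'.
rewrite !mass_likelihood ler_pM2r ?invr_gt0 ?card_Sn_gt0 // => Lle.
have L0 : 0 < likelihood q w.1.1 w.1.2.
  by move: w0; rewrite mass_likelihood pmulr_lgt0 // invr_gt0 card_Sn_gt0.
case: existsP => [_|[]]; first by rewrite mulr1.
exists (w'.2 * w.2^-1)%g; apply/and3P; split => //.
  by rewrite w'2; apply: contra err => /eqP E; rewrite -[pi'](mulgKV w.2) E mul1g.
rewrite leqNgt -agreement1 -agreement_pull -E2; apply/negP => lt.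
have := likelihood_lt q_ge0 _ qq lt L0.
by rewrite E2 sum_pull => /(_ erefl); rewrite -E2 -[w.1.1]E1 ltNge {1}E1 Lle.
Qed.

End Estimation.

(** * Achievability *)

Section UnionBound.
Variables (R : realType) (N : nat) (q : bool -> bool -> R) (U : {set 'I_N}).
Hypothesis q_ge0 : forall u v, 0 <= q u v.
Hypothesis q_sum1 : \sum_u \sum_v q u v = 1.
Hypothesis q11_gt0 : 0 < q true true.
Hypothesis q00_gt0 : 0 < q false false.
Implicit Types (tau : 'S_N) (S : {set 'I_N}).

Definition beaten (a b : graph N) : bool :=
  [exists tau : 'S_N, [&& perm_on U tau, tau != 1%g
       & (agreement 1 a b <= agreement (eperm tau) a b)%N]].

Lemma ler1_sum (I : finType) (P : pred I) (F : I -> R) i :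
  (forall j, 0 <= F j) -> P i -> 1 <= F i -> 1 <= \sum_(j | P j) F j.
Proof.
by move=> F0 Pi Fi; rewrite (bigD1 i) //=; apply: ler_wpDr => //; apply: sumr_ge0.
Qed.

Lemma beaten_le_sum : pairE q (fun a b => (beaten a b)%:R) <=
  \sum_(tau | perm_on U tau && (tau != 1%g))
    pairE q (fun a b => (agreement 1 a b <= agreement (eperm tau) a b)%N%:R).
Proof.
rewrite -pairE_sum; apply: pairE_le => // a b; rewrite /beaten.
case: existsP => [[tau /and3P[tU t1 le]]|_]; last by apply: sumr_ge0.
by apply: (ler1_sum (i := tau)) => //; rewrite ?tU ?t1 // le.
Qed.

Lemma agreement_moved tau a b :
  (agreement 1 a b <= agreement (eperm tau) a b)%N ->
  (\sum_(e in moved (eperm tau)) (a e && b e) <= moved_agreement (eperm tau) a b)%N.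
Proof.
rewrite /agreement (bigID (moved (eperm tau))) /=.
rewrite [leqRHS](bigID (moved (eperm tau))) /=.
rewrite [X in (_ + X <= _)%N](eq_bigr (fun e => (a e && b e : nat))); last first.
  by move=> e _; rewrite perm1.
rewrite [X in (_ <= _ + X)%N](eq_bigr (fun e => (a e && b e : nat))); last first.
  by move=> e; rewrite negbK => /eqP ->.
rewrite leq_add2r; under eq_bigr do rewrite perm1.
by [].
Qed.

(** The three sums are for small supports, supports [S] touched by few common edges, and
    permutations that create many coincidences. In the last case more than [k L / 16 - k] common
    edges are moved, and [32 <= L] makes this at least [k L / 32]. *)
Lemma beaten_le_split (k0 L : R) : 32 <= L ->
  pairE q (fun a b => (beaten a b)%:R) <=
  \sum_(tau | [&& perm_on U tau, tau != 1%g & #|psupport tau|%:R <= k0])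
    pairE q (fun a b => (agreement 1 a b <= agreement (eperm tau) a b)%N%:R)
  + \sum_(S : {set 'I_N} | (S \subset U) && (k0 < #|S|%:R))
    pairE q (fun a b =>
      ((\sum_(e in touches S) (a e && b e))%N%:R <= #|S|%:R * (L / 16))%R%:R)
  + \sum_(tau | perm_on U tau && (tau != 1%g))
    pairE q (fun a b => (#|psupport tau|%:R * (L / 32)
      <= (moved_agreement (eperm tau) a b)%:R)%R%:R).
Proof.
move=> L32; rewrite -!pairE_sum -!pairED; apply: pairE_le => // a b; rewrite /beaten.
case: existsP => [[tau /and3P[tU t1 le]]|_]; last first.
  by rewrite !addr_ge0 // sumr_ge0.
have [k_le|k_gt] := leP #|psupport tau|%:R k0.
  rewrite -addrA ler_wpDr ?addr_ge0 ?sumr_ge0 //.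
  by apply: (ler1_sum (i := tau)) => //; rewrite ?tU ?t1 // le.
have sU : psupport tau \subset U.
  by apply/fintype.subsetP => x; rewrite inE; apply: (fintype.subsetP tU).
have [few|many] := leP (\sum_(e in touches (psupport tau)) (a e && b e))%N%:R
   (#|psupport tau|%:R * (L / 16) : R).
  rewrite ler_wpDr ?sumr_ge0 // ler_wpDl ?sumr_ge0 //.
  by apply: (ler1_sum (i := psupport tau)) => //; rewrite ?sU ?k_gt // few.
rewrite ler_wpDl ?addr_ge0 ?sumr_ge0 //.
apply: (ler1_sum (i := tau)) => //; rewrite ?tU ?t1 //.
suff -> : #|psupport tau|%:R * (L / 32) <= (moved_agreement (eperm tau) a b)%:R by [].
have := leq_trans (touches_le_moved tau (fun e => a e && b e))
  (leq_add (agreement_moved le) (leqnn _)).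
rewrite -(ler_nat R) natrD => le'.
have : 0 <= (#|psupport tau|%:R : R) by [].
by nra.
Qed.

(** At most [k] of the [k (2 N - k - 1) / 2] edges touching the support are fixed; the rest are
    moved, and [d] is a lower bound for the determinant in [agreement_tail]. *)
Lemma tail_le_pow tau (d x : R) : 1 <= x -> 0 <= d ->
  d <= (x - 1) * (q true true * q false false / x - q true false * q false true) ->
  pairE q (fun a b => (agreement 1 a b <= agreement (eperm tau) a b)%N%:R)
  <= expR (- (#|psupport tau|%:R * ((2 * N%:R - #|psupport tau|%:R - 3) / 2 * d))).
Proof.
move=> x1 d0 dle; apply: le_trans (agreement_tail _ _ _ x1 _ _) _ => //.
rewrite ler_expR lerN2; apply: le_trans (_ : #|moved (eperm tau)|%:R * d <= _); last first.
  by apply: ler_wpM2l.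
rewrite mulrA; apply: ler_wpM2r => //.
have := card_touches_le_moved tau.
rewrite -(ler_nat R) natrD card_touchesR; lra.
Qed.

(** Lower tail of a binomial with weight [expR (- 1)] per common edge; the final division by 2 comes
    from [expR (- 1) <= 1 / 2]. *)
Lemma few_edges_le S (L : R) :
  pairE q (fun a b =>
      ((\sum_(e in touches S) (a e && b e))%N%:R <= #|S|%:R * (L / 16))%R%:R)
  <= expR (#|S|%:R * (L / 16)
           - #|S|%:R * (2 * N%:R - #|S|%:R - 1) / 2 * q true true / 2).
Proof.
set r := _ * (L / 16).
apply: le_trans (_ : expR r * pairE q (fun a b =>
   expR (- 1) ^+ (\sum_(e in touches S) (a e && b e))) <= _).
  rewrite -pairEZ; apply: pairE_le => // a b.
  rewrite -expRM_natl -expRD.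
  have [le|_] := boolP (_ <= r); last by rewrite expR_ge0.
  by rewrite -[leLHS]expR0 ler_expR; lra.
rewrite common_edges_gf // expRD; apply: ler_wpM2l; first exact: expR_ge0.
rewrite -card_touchesR.
have -> : - (#|touches S|%:R * q true true / 2) =
    #|touches S|%:R * (- (q true true / 2)) :> R by ring.
rewrite expRM_natl.
have e1 : expR (- 1) <= 1 / 2 :> R.
  by rewrite expRN div1r lef_pV2 ?posrE ?expR_gt0 //; have := expR_ge1Dx (1 : R); lra.
have q1 : q true true <= 1.
  rewrite -q_sum1 !big_boolE; have := q_ge0 true false.
  have := q_ge0 false true; have := q_ge0 false false; lra.
apply: lerXn2r; rewrite ?nnegrE ?expR_ge0 //.
  by have := expR_gt0 (- 1 : R); nra.
apply: le_trans (expR_ge1Dx _).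
have : 0 <= q true true * (1 / 2 - expR (- 1)) by rewrite mulr_ge0 ?subr_ge0 // ltW.
lra.
Qed.

End UnionBound.

(** * Error bounds in the dense and sparse regimes *)

Section ErrorBounds.
Variables (R : realType) (N : nat) (q : bool -> bool -> R) (U : {set 'I_N}).
Variables (p s c : R).
Hypothesis q_ge0 : forall u v, 0 <= q u v.
Hypothesis q_sum1 : \sum_u \sum_v q u v = 1.
Hypothesis q11_gt0 : 0 < q true true.
Hypothesis q00_gt0 : 0 < q false false.
Hypothesis q11E : q true true = p * s ^+ 2.
Hypothesis q10E : q true false = p * s * (1 - s).
Hypothesis q01E : q false true = p * s * (1 - s).
Hypothesis q00E : q false false = 1 - 2 * p * s + p * s ^+ 2.
Hypotheses (c_gt0 : 0 < c) (c_le1 : c <= 1) (p_ge0 : 0 <= p) (p_le : c <= 1 - p).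
Hypotheses (s_ge0 : 0 <= s) (s_le1 : s <= 1).

Local Notation P := (q true true).
Local Notation n := (#|U|%:R : R).
Local Notation L := (ln n).
(** With [y = p (1 - s)^2] one has [q00 = 1 - p + y], and [P] factors out of the determinant. The
    bounds on [y] are what the choices of [x] below rely on. *)
Let det_spec : exists2 y : R, 0 <= y <= p & forall x : R, x != 0 ->
  (x - 1) * (q true true * q false false / x - q true false * q false true)
  = q true true * ((x - 1) / x * (1 - p + y - x * y)).
Proof.
exists (p * (1 - s) ^+ 2); last first.
  by move=> x x0; rewrite q11E q10E q01E q00E; field.
have : 0 <= p * (s * (1 - s)) by rewrite !mulr_ge0 ?subr_ge0.
have : 0 <= p * s by rewrite mulr_ge0.
move=> *; apply/andP; split; [by rewrite mulr_ge0 ?sqr_ge0 | rewrite expr2; lra].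
Qed.

Let P_le1 : P <= 1.
Proof.
rewrite -q_sum1 !big_boolE; have := q_ge0 true false.
have := q_ge0 false true; have := q_ge0 false false; lra.
Qed.

Let card_leN (A : {set 'I_N}) : #|A|%:R <= N%:R :> R.
Proof. by rewrite ler_nat -[leqRHS]card_ord max_card. Qed.

Lemma expRN2ln m : (0 < m)%N -> expR (- (2 * ln m%:R)) = (m%:R ^+ 2)^-1 :> R.
Proof.
by move=> m0; rewrite expRN expRM_natl lnK // posrE ltr0n.
Qed.

(** With [x = 1 + c / 2] the determinant is at least [P c^2 / 8]. Since [k <= N] and [6 <= N], at
    least [k N / 4] edges move, so the exponent is at least [k N P c^2 / 32], hence [2 k L]: each
    permutation costs at most [n^(- 2 k)]. *)
Lemma dense_error_le : (6 <= N)%N -> (2 <= #|U|)%N ->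
  64 / c ^+ 2 * L <= N%:R * P ->
  pairE q (fun a b => (beaten U a b)%:R) <= 2 / n.
Proof.
have [c0 c1 pc p0] : [/\ 0 < c, c <= 1, c <= 1 - p & 0 <= p] by [].
move=> N6 n2 NP; apply: le_trans (beaten_le_sum U q_ge0) _.
have n0 : 0 < n by rewrite ltr0n (leq_trans _ n2).
have N6R : 6 <= N%:R :> R by rewrite ler_nat.
have c2 : 0 < c ^+ 2 by rewrite exprn_gt0.
have cc : 0 <= c * (1 - c) by rewrite mulr_ge0 ?subr_ge0 // ltW.
have NPL : 64 * L <= N%:R * P * c ^+ 2.
  by rewrite -ler_pdivrMr // mulrAC.
apply: le_trans (_ : \sum_(tau : 'S_N | perm_on U tau && (tau != 1%g))
    ((n ^+ 2)^-1) ^+ #|psupport tau| <= _).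
  apply: ler_sum => tau _; set k := #|psupport tau|.
  have kN : k%:R <= N%:R :> R by exact: card_leN.
  apply: le_trans (@tail_le_pow _ _ _ q_ge0 q_sum1 q11_gt0 q00_gt0 tau (P * (c ^+ 2 / 8)) (1 + c / 2) _ _ _) _.
  - by lra.
  - by rewrite mulr_ge0 ?divr_ge0 ?ltW.
  - have [y /andP[y_ge0 y_lep] ->] := det_spec; last by rewrite gt_eqF //; lra.
    apply: ler_wpM2l; first exact: ltW.
    have -> : c ^+ 2 / 8 = c / 4 * (c / 2) by field.
    apply: ler_pM; [lra | lra | | ].
      by rewrite ler_pdivlMr; lra.
    have : c * y <= c * 1 by rewrite ler_pM2l //; lra.
    by lra.
  rewrite -(expRN2ln (ltnW n2)) -expRM_natl ler_expR mulrN lerN2 -/k.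
  apply: ler_wpM2l => //.
  have Pc : 0 <= P * (c ^+ 2 / 8) by rewrite mulr_ge0 ?divr_ge0 ?ltW.
  apply: le_trans (_ : N%:R / 4 * (P * (c ^+ 2 / 8)) <= _); first lra.
  apply: ler_wpM2r => //; lra.
have nn : n * (n ^+ 2)^-1 = n^-1 by field; rewrite gt_eqF.
apply: le_trans (sum_perm_on _ _) _; rewrite ?nn //.
  by rewrite div1r lef_pV2 ?posrE // ler_nat.
Qed.

(** Three losses are subtracted from [N P] for each moved vertex: [B] because the determinant falls
    short of [P], [k0 / 2] because edges inside the support are shared by two moved vertices, and
    3/2 for the lower-order terms in the count of moved edges. *)
Lemma small_support_le (B x k0 : R) (tau : 'S_N) : 1 <= x -> x * p <= 1 ->
  (3 <= N)%N -> N%:R * P * (1 / x + x * p) <= B -> #|psupport tau|%:R * P <= k0 ->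
  pairE q (fun a b => (agreement 1 a b <= agreement (eperm tau) a b)%N%:R)
  <= expR (- (N%:R * P - B - k0 / 2 - 3 / 2)) ^+ #|psupport tau|.
Proof.
move=> x1 xp N3 NB; set k := #|psupport tau| => kP.
have x0 : 0 < x by lra.
have p0 := p_ge0.
have kN : k%:R <= N%:R :> R by exact: card_leN.
have k_ge0 : 0 <= k%:R :> R by [].
have N3R : 3 <= N%:R :> R by rewrite ler_nat.
pose d := P * ((1 - 1 / x) * (1 - x * p)).
have x1V : 0 <= 1 - 1 / x by rewrite subr_ge0 ler_pdivrMr // mul1r.
have x1V' : 0 <= 1 / x by rewrite divr_ge0 // ltW.
have P_ge0 : 0 <= P by exact: ltW.
have dge0 : 0 <= d by rewrite !mulr_ge0 ?subr_ge0 //; lra.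
have xp0 : 0 <= x * p by rewrite mulr_ge0 // ltW.
apply: le_trans (@tail_le_pow _ _ _ q_ge0 q_sum1 q11_gt0 q00_gt0 tau d x _ _ _) _ => //.
  have [y /andP[y_ge0 y_lep] ->] := det_spec; rewrite ?gt_eqF // /d; apply: ler_wpM2l => //.
  have -> : (x - 1) / x = 1 - 1 / x by field; rewrite gt_eqF.
  apply: ler_wpM2l => //; have : (x - 1) * y <= (x - 1) * p by rewrite ler_wpM2l //; lra.
  lra.
rewrite -expRM_natl ler_expR mulrN lerN2 -/k; apply: ler_wpM2l => //.
have d_leP : d <= P by rewrite /d ler_piMr // mulr_ile1 //; lra.
have d_geP : P * (1 - 1 / x - x * p) <= d.
  rewrite /d; apply: ler_wpM2l => //.
  have : 0 <= 1 / x * (x * p) by rewrite mulr_ge0.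
  lra.
have h1 : N%:R * (P * (1 - 1 / x - x * p)) <= N%:R * d by rewrite ler_wpM2l.
have h2 : k%:R * d <= k%:R * P by rewrite ler_wpM2l.
have h3 := P_le1.
lra.
Qed.

(* With 32 C, the exponent #|S| L / 16 is at least 2 n, which beats the 2^n
   possible supports. *)
Lemma few_edges_sum_le (C : R) : (2 <= N)%N -> (0 < #|U|)%N -> 0 < C ->
  L <= N%:R * P -> N%:R * P <= C * L ->
  \sum_(S : {set 'I_N} | (S \subset U) && (32 * C < #|S|%:R * P))
    pairE q (fun a b =>
      ((\sum_(e in touches S) (a e && b e))%N%:R <= #|S|%:R * (L / 16))%R%:R)
  <= 1 / n.
Proof.
move=> N2 n0 C0 LNP NPC.
have N2R : 2 <= N%:R :> R by rewrite ler_nat.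
have n0R : 0 < n by rewrite ltr0n.
have nN := card_leN U.
apply: le_trans (_ : \sum_(S in powerset U) expR (- (2 * n)) <= _).
  rewrite [leLHS]big_mkcond [leRHS]big_mkcond; apply: ler_sum => S _.
  rewrite powersetE; case: (S \subset U) => //=.
  case: ifP => [kP|_]; last exact: expR_ge0.
  apply: le_trans (few_edges_le q_ge0 q_sum1 S L) _.
  rewrite ler_expR; move: kP; have := card_leN S; set k := (_%:R : R) => kN kP.
  have k0 : 0 <= k by [].
  have h1 : k * (N%:R * P) <= k * (C * L) by rewrite ler_wpM2l.
  have h2 : k * L <= k * (N%:R * P) by rewrite ler_wpM2l.
  have h3 : 32 * C * N%:R <= k * P * N%:R by rewrite ler_wpM2r // ltW.
  have h4 : 32 * N%:R <= k * L by rewrite -(ler_pM2l C0); lra.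
  have h5 : 0 <= k * P * (2 * N%:R - k - 1 - N%:R / 2).
    by rewrite mulr_ge0 ?mulr_ge0 ?(ltW q11_gt0) //; lra.
  lra.
rewrite sumr_const card_powerset -[leLHS]mulr_natl natrX.
have -> : expR (- (2 * n)) = expR (- 2) ^+ #|U|.
  by rewrite -expRM_natl; congr expR; ring.
rewrite -exprMn; apply: le_trans (_ : expR (- 1) ^+ #|U| <= _).
  apply: lerXn2r; rewrite ?nnegrE ?mulr_ge0 ?expR_ge0 //.
  have -> : - 2 = - 1 + - 1 :> R by ring.
  rewrite expRD mulrA ler_piMl ?expR_ge0 // expRN ler_pdivrMr ?expR_gt0 //.
  by have := expR_ge1Dx (1 : R); lra.
rewrite -expRM_natl mulrN mulr1 expRN div1r lef_pV2 ?posrE ?expR_gt0 //.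
by have := expR_ge1Dx n; lra.
Qed.

(* 128 gives exp (- 128 k L / 32) = n^(- 4 k), half of which pays for the moment
   generating function of the coincidences. *)
Lemma large_support_le (C : R) (tau : 'S_N) : (1 <= N)%N -> 0 < C -> 0 <= L ->
  N%:R * P <= C * L -> expR 128 * p * C <= 1 -> expR 128 ^+ 2 * C * P <= 2 ->
  pairE q (fun a b => (#|psupport tau|%:R * (L / 32)
      <= (moved_agreement (eperm tau) a b)%:R)%R%:R)
  <= expR (- (2 * L)) ^+ #|psupport tau|.
Proof.
move=> N1 C0 L0 NPC h1 h2.
have N1R : 1 <= N%:R :> R by rewrite ler1n.
apply: le_trans (moved_agreement_tail _ _ _ _ (theta := 128) _ _ _) _ => //.
set k := #|psupport tau|; set Y := expR 128 in h1 h2 *.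
have kN : k%:R <= N%:R :> R by exact: card_leN.
have Y1 : 1 <= Y by rewrite -[leLHS]expR0 ler_expR.
have k0 : 0 <= k%:R :> R by [].
rewrite -expRD -expRM_natl ler_expR.
set v := _ + _ / 2.
have PE : (P + q true false) * (P + q false true) = p * P.
  by rewrite q11E q10E q01E; ring.
have P0 : 0 <= P by exact: ltW.
have p0 := p_ge0.
have pP0 : 0 <= p * P by rewrite mulr_ge0.
have v0 : 0 <= v.
  by rewrite /v PE addr_ge0 ?divr_ge0 ?sqr_ge0 // mulr_ge0 // subr_ge0.
have vle : v <= Y * (p * P) + Y ^+ 2 * P ^+ 2 / 2.
  rewrite /v PE; apply: lerD; first by apply: ler_wpM2r => //; lra.
  rewrite -exprMn ler_pM2r ?invr_gt0 //; apply: lerXn2r; rewrite ?nnegrE ?mulr_ge0 //; lra.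
have tle : #|moved (eperm tau)|%:R <= k%:R * N%:R :> R.
  apply: le_trans (_ : #|touches (psupport tau)|%:R <= _).
    by rewrite ler_nat card_moved_le.
  rewrite card_touchesR -/k -mulrA ler_wpM2l //; lra.
have h3 : #|moved (eperm tau)|%:R * v <= k%:R * N%:R * v by rewrite ler_wpM2r.
have h4 : N%:R * v <= 2 * L.
  apply: le_trans (ler_wpM2l _ vle) _; first lra.
  have h5 : Y * p * (N%:R * P) <= Y * p * (C * L) by rewrite ler_wpM2l // mulr_ge0 //; lra.
  have h6 : Y * p * C * L <= 1 * L by rewrite ler_wpM2r.
  have h7 : Y ^+ 2 * P * (N%:R * P) <= Y ^+ 2 * P * (C * L).
    by rewrite ler_wpM2l // mulr_ge0 // sqr_ge0.
  have h8 : Y ^+ 2 * C * P * L <= 2 * L by rewrite ler_wpM2r.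
  lra.
have h9 : k%:R * (N%:R * v) <= k%:R * (2 * L) by rewrite ler_wpM2l.
lra.
Qed.

(** The split is at [k P = 32 C]. Small supports give a geometric series whose ratio is the
    exponential on the right, at most [expR (- 1)] by the last hypothesis; the other two sums
    contribute [1 / n] and [2 / n]. *)
Lemma sparse_error_le (B C : R) : (3 <= N)%N -> 32 <= L -> 0 < C ->
  N%:R * P <= C * L -> L * p <= 1 -> N%:R * P * (1 / L + L * p) <= B ->
  expR 128 * p * C <= 1 -> expR 128 ^+ 2 * C * P <= 2 -> 0 <= B ->
  1 <= N%:R * P - L - (B + 16 * C + 3 / 2) ->
  pairE q (fun a b => (beaten U a b)%:R) <=
  2 * expR (B + 16 * C + 3 / 2 - (N%:R * P - L)) + 3 / n.
Proof.
move=> N3 L32 C0 NPC Lp NPB h1 h2 B0 gap.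
have n2 : (2 <= #|U|)%N.
  rewrite leqNgt; apply/negP; rewrite ltnS => n1.
  suff : L <= 0 by lra.
  by apply: ln_le0; rewrite lern1.
have n0 : 0 < n by rewrite ltr0n (leq_trans _ n2).
have L0 : 0 <= L by lra.
have nL : n = expR L by rewrite lnK.
have P0 : 0 <= P by exact: ltW.
apply: le_trans (beaten_le_split U q_ge0 (32 * C / P) L32) _.
have -> : 2 * expR (B + 16 * C + 3 / 2 - (N%:R * P - L)) + 3 / n =
  2 * (n * expR (- (N%:R * P - B - 32 * C / 2 - 3 / 2))) + 1 / n + 2 / n.
  rewrite [X in X * expR (- _)]nL -expRD.
  rewrite [in RHS](_ : L + _ = B + 16 * C + 3 / 2 - (N%:R * P - L)); last by field.
  by field; rewrite gt_eqF.
apply: lerD; first apply: lerD.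
- set y0 := expR (- _).
  apply: le_trans (_ : \sum_(tau : 'S_N | perm_on U tau && (tau != 1%g))
    y0 ^+ #|psupport tau| <= _).
    rewrite [leLHS]big_mkcond [leRHS]big_mkcond; apply: ler_sum => tau _.
    case: (perm_on U tau) => //=; case: (tau != 1%g) => //=.
    case: ifP => [kP|_]; last by rewrite exprn_ge0 // expR_ge0.
    (* x = L costs only O(1) in N det: both N P / L and N P L p are bounded. *)
    apply: (small_support_le (x := L)) => //; first lra.
    by rewrite -ler_pdivlMr.
  apply: sum_perm_on; first exact: expR_ge0.
  rewrite [X in X * y0]nL /y0 -expRD.
  apply: le_trans (_ : expR (- 1) <= _); first by rewrite ler_expR; lra.
  rewrite expRN div1r lef_pV2 ?posrE ?expR_gt0 //.
  by have := expR_ge1Dx (1 : R); lra.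
- apply: le_trans (few_edges_sum_le _ _ C0 _ NPC); rewrite ?(ltnW n2) ?(ltnW N3) //; last lra.
  rewrite le_eqVlt; apply/orP; left; apply/eqP/eq_bigl => S.
  by rewrite ltr_pdivrMr.
- have nn : n * (n ^+ 2)^-1 = n^-1 by field; rewrite gt_eqF.
  apply: le_trans (_ : \sum_(tau : 'S_N | perm_on U tau && (tau != 1%g))
    ((n ^+ 2)^-1) ^+ #|psupport tau| <= _).
    apply: ler_sum => tau _; rewrite -(expRN2ln (ltnW n2)).
    by apply: (large_support_le (C := C)) => //; rewrite (leq_trans _ N3).
  apply: le_trans (sum_perm_on _ _) _; rewrite ?nn //.
  by rewrite div1r lef_pV2 ?posrE // ler_nat.
Qed.

End ErrorBounds.

(** The thresholds depend on [c] alone, so the bound is uniform along the sequence and only the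
    divergence of the gap remains for the limit. *)
Lemma achievability_le (R : realType) (c : R) : 0 < c -> c <= 1 ->
  exists L0 B : R, forall (N : nat) (q : bool -> bool -> R) (U : {set 'I_N}) (p s : R),
  prob_vector q -> 0 < q true true -> 0 < q false false ->
  q true true = p * s ^+ 2 -> q true false = p * s * (1 - s) ->
  q false true = p * s * (1 - s) -> q false false = 1 - 2 * p * s + p * s ^+ 2 ->
  0 <= p -> c <= 1 - p -> 0 <= s -> s <= 1 ->
  let n := #|U|%:R : R in let L := ln n in
  L0 <= L -> c ^+ 2 * L ^+ 4 <= n * s ^+ 2 ->
  B + 1 <= N%:R * q true true - L ->
  pairE q (fun a b => (beaten U a b)%:R)
  <= 2 * expR (B - (N%:R * q true true - L)) + 3 / n.
Proof.
move=> c0 c1.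
have [Y YE] : {Y : R | Y = expR 128} by exists (expR 128).
have [C CE] : {C : R | C = 64 / c ^+ 2} by exists (64 / c ^+ 2).
have [D DE] : {D : R | D = C / c ^+ 2} by exists (C / c ^+ 2).
(* Each summand of the first threshold meets one requirement on [L]: 32 for the split, [D] for
   [L p <= 1], and the last two for the smallness conditions involving [expR 128]. In the second,
   [C + C * D] bounds the determinant loss. *)
exists (32 + D + Y * C * D + 2 * Y ^+ 2 * C ^+ 2), (C + C * D + 16 * C + 3 / 2).
move=> N q U p s [q_ge0 q_sum1] q11 q00 q11E q10E q01E q00E p0 pc s0 s1 n L.
have nE : n = #|U|%:R by [].
have LE : L = ln n by [].
clearbody L.
clearbody n.
have c2 : 0 < c ^+ 2 by rewrite exprn_gt0.
have Y0 : 0 < Y by rewrite YE expR_gt0.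
have C0 : 0 < C by rewrite CE divr_gt0.
have D0 : 0 < D by rewrite DE divr_gt0.
have YCD : 0 <= Y * C * D by rewrite !mulr_ge0 // ltW.
have YC2 : 0 <= 2 * Y ^+ 2 * C ^+ 2 by rewrite !mulr_ge0 ?sqr_ge0 ?exprn_ge0 ?ltW.
have CD0 : 0 <= C * D by rewrite mulr_ge0 // ltW.
move=> LL0 sL gap.
have L32 : 32 <= L by lra.
have n_gt0 : 0 < n.
  have : 0 <= n by rewrite nE.
  rewrite le_eqVlt => /predU1P[n0|//]; move: L32.
  by rewrite LE -n0 ln0 //; lra.
have n33 : 33 <= n.
  rewrite -(lnK (x := n)) ?posrE //.
  by apply: le_trans (expR_ge1Dx _); rewrite -LE; lra.
have nN : n <= N%:R by rewrite nE ler_nat -[leqRHS]card_ord max_card.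
have n33N : (33 <= #|U|)%N by rewrite -(ler_nat R) -nE.
have N33 : (33 <= N)%N by rewrite -(ler_nat R); exact: (le_trans n33).
have [NPC|NPC] := leP (C * L) (N%:R * q true true).
  rewrite nE; apply: le_trans (dense_error_le (c := c) q_ge0 q_sum1 q11 q00 q11E q10E q01E q00E _ _ _ _ _ _ _ _ _) _ => //.
  - exact: leq_trans N33.
  - exact: leq_trans n33N.
  - by rewrite -CE -nE -LE.
  rewrite ler_wpDl ?mulr_ge0 ?expR_ge0 // ler_wpM2r ?invr_ge0 //; lra.
have P0 : 0 <= q true true by exact: ltW.
have L0 : 0 < L by lra.
(* Since [p n s^2 <= N P <= C L] in this regime, the lower bound on [s] forces [p] to be small. *)
have pL3 : p * L ^+ 3 <= D.
  rewrite DE ler_pdivlMr // -(ler_pM2r L0).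
  have h1 : p * (c ^+ 2 * L ^+ 4) <= p * (n * s ^+ 2) by rewrite ler_wpM2l.
  have h2 : n * q true true <= N%:R * q true true by rewrite ler_wpM2r.
  have h3 : n * q true true = p * (n * s ^+ 2) by rewrite q11E; ring.
  lra.
have L1 : 1 <= L by lra.
have pL2 : p * L ^+ 2 <= D.
  apply: le_trans pL3; apply: ler_wpM2l => //; rewrite [leRHS]exprS.
  by rewrite ler_peMl // exprn_ge0 // ltW.
have pL1 : p * L <= D.
  apply: le_trans pL2; apply: ler_wpM2l => //; rewrite [leRHS]expr2.
  by rewrite ler_peMl // ltW.
have h1 : L * p <= 1.
  by rewrite -(ler_pM2r L0); lra.
have h2 : Y * p * C <= 1.
  rewrite -(ler_pM2r L0).
  by have := ler_wpM2l (mulr_ge0 (ltW Y0) (ltW C0)) pL1; lra.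
(* From [expR (L / 2) >= L / 2]; with [n P <= C L] it yields that [P] is of order at most
   [1 / L]. *)
have nL2 : L ^+ 2 / 4 <= n.
  rewrite -(lnK (x := n)) ?posrE // -LE.
  have -> : L = L / 2 + L / 2 by field.
  rewrite expRD -expr2.
  have -> : (L / 2 + L / 2) ^+ 2 / 4 = (L / 2) ^+ 2 by field.
  apply: lerXn2r; rewrite ?nnegrE ?expR_ge0 ?divr_ge0 ?ltW //.
  by apply: lt_le_trans (expR_ge1Dx _); lra.
have PL : q true true * L <= 4 * C.
  rewrite -(ler_pM2r L0).
  have := ler_wpM2r P0 (le_trans nL2 nN); lra.
have h3 : Y ^+ 2 * C * q true true <= 2.
  rewrite -(ler_pM2r L0).
  by have := ler_wpM2l (mulr_ge0 (sqr_ge0 Y) (ltW C0)) PL; lra.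
have h4 : N%:R * q true true * (1 / L + L * p) <= C + C * D.
  apply: le_trans (_ : C * L * (1 / L + L * p) <= _).
    apply: ler_wpM2r; last exact: ltW.
    by rewrite addr_ge0 ?divr_ge0 ?mulr_ge0 // ltW.
  have -> : C * L * (1 / L + L * p) = C + C * (p * L ^+ 2) by field; rewrite gt_eqF.
  by rewrite lerD2l ler_pM2l.
rewrite LE nE; rewrite {}LE {}nE in L32 NPC h1 h4 gap.
apply: (sparse_error_le q_ge0 q_sum1 q11 q00 q11E q10E q01E q00E p0 s0 s1 (B := C + C * D) (C := C)) => //.
- exact: leq_trans N33.
- exact: ltW.
- by rewrite -YE.
- by rewrite -YE.
- lra.
- lra.
Qed.

(** * Converse *)

Section Converse.
Variables (R : realType) (N : nat) (q : bool -> bool -> R) (V : {set 'I_N}).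
Hypothesis q_ge0 : forall u v, 0 <= q u v.
Hypothesis q_sum1 : \sum_u \sum_v q u v = 1.
Implicit Types (a b : graph N) (u v : 'I_N) (w : outcome N).

(** Isolation is meant in the intersection graph of [a] and [b]. *)
Definition isolated a b u : bool :=
  (\sum_(e in touches [set u]) (a e && b e) == 0)%N.

Definition isolated_pair a b (z : 'I_N * 'I_N) : bool :=
  [&& z.1 \notin V, z.2 \notin V, z.1 != z.2, isolated a b z.1 & isolated a b z.2].

Lemma isolatedP a b u : reflect (forall e : edge N, u \in val e -> ~~ (a e && b e))
  (isolated a b u).
Proof.
rewrite /isolated sum_nat_eq0; apply: (iffP forall_inP) => H e.
  move=> ue; rewrite -eqb0; apply: H; rewrite inE.
  by apply/pred0Pn; exists u => /=; rewrite ue inE eqxx.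
rewrite inE => /pred0Pn[x /= /andP[xe]]; rewrite inE => /eqP xu.
by rewrite eqb0; apply: H; rewrite -xu.
Qed.

Lemma isolated2 a b u v : isolated a b u && isolated a b v =
  (\sum_(e in touches [set u; v]) (a e && b e) == 0)%N.
Proof.
rewrite sum_nat_eq0; apply/andP/forall_inP => [[/isolatedP Hu /isolatedP Hv] e|H].
  rewrite inE => /pred0Pn[x /= /andP[xe]]; rewrite !inE eqb0.
  by case/orP => /eqP xE; [apply: Hu | apply: Hv]; rewrite -xE.
by split; apply/isolatedP => e xe; rewrite -eqb0; apply: H; rewrite inE;
  apply/pred0Pn; [exists u | exists v] => /=; rewrite xe !inE eqxx ?orbT.
Qed.

(** Edges at [u] or [v] contribute nothing to the agreement on the left, and all other edges are
    fixed by the swap. *)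
Lemma agreement_tperm a b u v : isolated a b u -> isolated a b v ->
  (\sum_e (a e && b e) <= \sum_e (a e && pull (tperm u v) b e))%N.
Proof.
move=> /isolatedP Hu /isolatedP Hv; apply: leq_sum => e _; rewrite ffunE.
have [ue|ue] := boolP (u \in val e); first by rewrite (negPf (Hu _ ue)).
have [ve|ve] := boolP (v \in val e); first by rewrite (negPf (Hv _ ve)).
suff -> : edge_perm (tperm u v) e = e by [].
apply: val_inj => /=; rewrite -[RHS]imset_id; apply: eq_in_imset => x xe.
by rewrite tpermD //; [apply: contra ue | apply: contra ve] => /eqP ->.
Qed.

Definition swap_pair (z : option ('I_N * 'I_N)) : 'S_N :=
  if z is Some (u, v) then tperm u v else 1%g.

(* An outcome with two isolated non-seed vertices is confused with the one
   where they are swapped: same observation, and at least as likely. *)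
Definition confuse w : outcome N :=
  let tau := swap_pair [pick z | isolated_pair w.1.1 w.1.2 z] in
  (w.1.1, pull tau w.1.2, (tau * w.2)%g).

Lemma confuseP w : q true false * q false true <= q true true * q false false ->
  [exists z, isolated_pair w.1.1 w.1.2 z] ->
  [/\ observe V (confuse w) = observe V w, (confuse w).2 != w.2
    & mass q w <= mass q (confuse w)].
Proof.
move=> qq /existsP[z0 Hz0]; rewrite /confuse.
case: pickP => [[u v] /and5P[/= uV vV uv iu iv]|/(_ z0)]; last by rewrite Hz0.
split.
- case: w {Hz0 iu iv} => -[a b] pi /=; apply: observe_pull.
  apply/fintype.subsetP => x; rewrite !inE.
  by apply: contraR; rewrite negbK => xV; rewrite tpermD //; apply: contraTneq xV => <-.
- apply: contra uv => /eqP/(congr1 (fun t => t * w.2^-1)%g); rewrite mulgK mulgV.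
  by move/permP/(_ u); rewrite tpermL perm1 => ->.
- rewrite !mass_likelihood /= ler_pM2r ?invr_gt0 ?card_Sn_gt0 //.
  by apply: likelihood_le => //; rewrite ?sum_pull //; apply: agreement_tperm.
Qed.

(** Split the event by whether [h] is correct. On the correct part [confuse] is injective, because
    the observation determines the estimate, hence the alignment and the outcome; its image consists
    of errors and has at least as much mass. Each part is thus at most the error probability. *)
Lemma isolated_pair_le_error (h : estimator N) :
  q true false * q false true <= q true true * q false false ->
  pairE q (fun a b => [exists z, isolated_pair a b z]%:R) <= 2 * error_prob q V h.
Proof.
move=> qq; rewrite -sum_mass.
pose W w := [exists z, isolated_pair w.1.1 w.1.2 z].
pose A := [set w : outcome N | W w && (h (observe V w) == w.2)].
have -> : \sum_w mass q w * (W w)%:R = \sum_(w | W w) mass q w.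
  rewrite [RHS]big_mkcond; apply: eq_bigr => w _.
  by case: (W w); rewrite ?mulr1 ?mulr0.
rewrite (bigID (fun w => h (observe V w) == w.2)) /= mulr_natl mulr2n.
apply: lerD; last first.
  rewrite [leLHS]big_mkcond /error_prob /Pr [leRHS]big_mkcond.
  apply: ler_sum => w _; case: (W w) => //=.
  by case: ifP => // _; apply: mass_ge0.
apply: le_trans (_ : \sum_(w in A) mass q (confuse w) <= _).
  rewrite [leRHS](eq_bigl (fun w => W w && (h (observe V w) == w.2))); last first.
    by move=> w; rewrite inE.
  by apply: ler_sum => w /andP[Ww _]; case: (confuseP qq Ww).
rewrite -(big_imset (mass q)) /=; last first.
  move=> w1 w2; rewrite !inE => /andP[W1 /eqP h1] /andP[W2 /eqP h2] E12.
  case: (confuseP qq W1) => o1 _ _; case: (confuseP qq W2) => o2 _ _.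
  have oE : observe V w1 = observe V w2 by rewrite -o1 E12 o2.
  case: (observe_inv oE); rewrite -h1 -h2 oE mulgV => E1 _ E2.
  have E3 : w1.2 = w2.2 by rewrite -h1 -h2 oE.
  have E4 : w1.1.2 = w2.1.2.
    by rewrite E2; apply/ffunP => e; rewrite ffunE edge_perm1.
  by case: w1 w2 E1 E3 E4 {W1 W2 h1 h2 E12 o1 o2 oE E2} => -[a b] c [[a' b'] c'] /= -> -> ->.
rewrite [leLHS]big_mkcond /error_prob /Pr [leRHS]big_mkcond.
apply: ler_sum => w' _; case: imsetP => [[w]|_]; last first.
  by case: ifP => // _; apply: mass_ge0.
rewrite inE => /andP[Ww /eqP hw] ->; case: (confuseP qq Ww) => -> ne _.
by rewrite hw eq_sym ne.
Qed.

Local Notation r := (1 - q true true).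
Local Notation n := (#|~: V|%:R : R).

Lemma prob_no_common_edge S :
  pairE q (fun a b => (\sum_(e in touches S) (a e && b e) == 0)%N%:R) = r ^+ #|touches S|.
Proof.
transitivity (pairE q (fun a b => 0 ^+ (\sum_(e in touches S) (a e && b e)))).
  by apply: eq_pairE => a b; rewrite expr0n.
by rewrite common_edges_gf // subr0 mul1r.
Qed.

Lemma card_touches1 u : #|touches [set u]| = N.-1.
Proof.
have N0 : (0 < N)%N by apply: leq_ltn_trans (ltn_ord u).
apply/eqP; rewrite -(eqr_nat R) card_touchesR cards1 -subn1 natrB //.
by apply/eqP; field.
Qed.

Lemma card_touches2 u v : u != v -> #|touches [set u; v]| = (N.-1 + N - 2)%N.
Proof.
move=> uv; have N2 : (2 <= N)%N.
  have <- : #|[set u; v]| = 2%N by rewrite cards2 uv.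
  by rewrite -[leqRHS](card_ord N) max_card.
have -> : (N.-1 + N - 2 = 2 * N - 3)%N by lia.
apply/eqP; rewrite -(eqr_nat R) card_touchesR cards2 uv /= natrB; last by lia.
by rewrite natrM; apply/eqP; field.
Qed.

(** Chebyshev for the number [Y] of isolated non-seeds, of mean [mu]: without an isolated pair
    [Y <= 1], a deviation of at least [mu - 1]. The variance is at most [mu + mu^2 / r - mu^2], and
    [10 <= mu], [9 / 10 <= r] bring the failure probability below 1/2. *)
Lemma isolated_pair_prob :
  10 <= n * r ^+ N.-1 -> q true true <= 1 / 10 ->
  1 / 2 <= pairE q (fun a b => [exists z, isolated_pair a b z]%:R).
Proof.
set mu := _ * _ => mu10 P10.
pose Y a b : R := \sum_(u in ~: V) (isolated a b u)%:R.
have r0 : 0 < r by lra.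
have EY : pairE q Y = mu.
  rewrite pairE_sum (eq_bigr (fun=> r ^+ N.-1)) ?sumr_const -?[LHS]mulr_natl //.
  by move=> u _; rewrite prob_no_common_edge card_touches1.
have N2 : (2 <= N)%N.
  rewrite leqNgt; apply/negP => N1.
  have : n <= 1 by rewrite lern1 -ltnS (leq_ltn_trans (max_card _)) ?card_ord.
  have r1 : r ^+ N.-1 <= 1.
    by apply: exprn_ile1; [exact: ltW | have := q_ge0 true true; lra].
  have : 0 <= r ^+ N.-1 by rewrite exprn_ge0 // ltW.
  by move: mu10; rewrite /mu; have : 0 <= n by []; nra.
(* Two vertices touch [2 N - 3] edges, one fewer than independence would give, hence the extra
   factor [r]; [2 <= N] keeps the subtraction from truncating. *)
have mE : n ^+ 2 * r ^+ (N.-1 + N - 2) * r = mu ^+ 2.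
  rewrite /mu exprMn -mulrA -exprSr -exprM; congr (_ * r ^+ _); lia.
have EY2 : pairE q (fun a b => Y a b ^+ 2) <= mu + mu ^+ 2 / r.
  rewrite (@eq_pairE _ _ q _ (fun a b =>
     \sum_(u in ~: V) \sum_(v in ~: V) (isolated a b u && isolated a b v)%:R)); last first.
    move=> a b; rewrite expr2 /Y mulr_suml; apply: eq_bigr => u _.
    by rewrite mulr_sumr; apply: eq_bigr => v _; rewrite -natrM mulnb.
  rewrite pairE_sum; apply: le_trans (_ : \sum_(u in ~: V)
     (r ^+ N.-1 + n * r ^+ (N.-1 + N - 2)) <= _); last first.
    rewrite sumr_const -[leLHS]mulr_natl mulrDr lerD2l.
    by rewrite -mE mulfK ?gt_eqF // mulrA expr2.
  apply: ler_sum => u uV; rewrite pairE_sum (bigD1 u) //=; apply: lerD.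
    rewrite (@eq_pairE _ _ q _ (fun a b => (isolated a b u)%:R)); last first.
      by move=> a b; rewrite andbb.
    by rewrite prob_no_common_edge card_touches1.
  apply: le_trans (_ : \sum_(v in ~: V) r ^+ (N.-1 + N - 2) <= _); last first.
    by rewrite sumr_const -[leLHS]mulr_natl.
  rewrite [leLHS]big_mkcond [leRHS]big_mkcond; apply: ler_sum => v _.
  case: (v \in ~: V) => //=; case: ifPn => [vu|_]; last by rewrite exprn_ge0 // ltW.
  rewrite (@eq_pairE _ _ q _ (fun a b => (\sum_(e in touches [set u; v]) (a e && b e) == 0)%N%:R)).
    by rewrite prob_no_common_edge card_touches2 // eq_sym.
  by move=> a b; rewrite isolated2.
set EW := pairE q _.
have cheb : (1 - EW) * (mu - 1) ^+ 2 <= mu + mu ^+ 2 / r - mu ^+ 2.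
  apply: le_trans (_ : pairE q (fun a b =>
      Y a b ^+ 2 + (- (2 * mu)) * Y a b + mu ^+ 2 * 1) <= _); last first.
    by rewrite !pairED !pairEZ EY pairE1 //; lra.
  have -> : 1 - EW = pairE q (fun a b => 1 + -1 * [exists z, isolated_pair a b z]%:R).
    by rewrite pairED pairEZ pairE1 // mulN1r.
  rewrite mulrC -pairEZ.
  apply: pairE_le => // a b.
  have -> : Y a b ^+ 2 + - (2 * mu) * Y a b + mu ^+ 2 * 1 = (Y a b - mu) ^+ 2 by ring.
  case: existsP => [_|none]; first by rewrite mulr1 addrN mulr0 sqr_ge0.
  rewrite mulr0 addr0 mulr1 -[leRHS]sqrrN opprB.
  suff Y1 : Y a b <= 1.
    by apply: lerXn2r; rewrite ?nnegrE; lra.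
  have [u Hu|all0] := pickP (fun u => (u \in ~: V) && isolated a b u); last first.
    by rewrite /Y big1 // => u uV; have := all0 u; rewrite /= uV /= => ->.
  case/andP: Hu => uV iu; rewrite /Y (bigD1 u) //= iu big1 ?addr0 // => v /andP[vV vu].
  case: (boolP (isolated a b v)) => // iv; case: none; exists (u, v).
  by move: uV vV; rewrite /isolated_pair !inE /= => -> ->; rewrite eq_sym vu iu iv.
have rV : 1 / r <= 10 / 9.
  by rewrite ler_pdivrMr //; lra.
have m2 : mu ^+ 2 * (1 / r) <= mu ^+ 2 * (10 / 9) by rewrite ler_wpM2l // sqr_ge0.
have m3 : mu * 10 <= mu * mu by rewrite ler_wpM2l //; lra.
have [//|EW_lt] := leP (1 / 2) EW.
have m4 : 1 / 2 * (mu - 1) ^+ 2 <= (1 - EW) * (mu - 1) ^+ 2.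
  by rewrite ler_wpM2r ?sqr_ge0 //; lra.
exfalso; move: m4 cheb m2 m3; rewrite !expr2; lra.
Qed.

End Converse.

Local Open Scope classical_set_scope.

(** From [1 - P >= expR (- P / (1 - P))] the mean is at least the exponential of
    [L - N P - N P^2 / (1 - P)]. Since [L P <= 4], the correction is at most 8, so the exponent is
    at least 9 and [1 + 9 = 10]. *)
Lemma isolated_mean_ge (R : realType) (N n : nat) (P : R) : (n <= N)%N ->
  0 <= P -> 40 <= ln (n%:R : R) -> 17 <= ln n%:R - N%:R * P ->
  P <= 1 / 10 /\ 10 <= n%:R * (1 - P) ^+ N.-1.
Proof.
move=> nN P0; have [L LE] : {L : R | L = ln n%:R} by exists (ln n%:R).
rewrite -LE => L40 gap.
have n0 : (0 < n)%N.
  by case: n LE {nN gap} => // LE; move: L40; rewrite LE ln0 //; lra.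
have n0R : 0 < n%:R :> R by rewrite ltr0n.
have nE : n%:R = expR L by rewrite LE lnK.
have nL2 : L ^+ 2 <= 4 * n%:R.
  have h : (L / 2) ^+ 2 <= expR (L / 2) ^+ 2.
    apply: lerXn2r; rewrite ?nnegrE ?expR_ge0 //; first lra.
    by apply: le_trans (expR_ge1Dx _); lra.
  rewrite nE (_ : expR L = expR (L / 2) ^+ 2); first by lra.
  by rewrite -expRM_natl; congr expR; field.
have nNR : n%:R <= N%:R :> R by rewrite ler_nat.
have nP : n%:R * P <= N%:R * P by rewrite ler_wpM2r.
have L2P : L ^+ 2 * P <= 4 * L.
  have := ler_wpM2r P0 nL2; lra.
have LP : L * P <= 4.
  by rewrite -(ler_pM2l (_ : 0 < L)); [move: L2P; rewrite expr2; lra | lra].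
have P10 : P <= 1 / 10.
  by have : 40 * P <= L * P by [apply: ler_wpM2r]; lra.
split=> //.
have r0 : 0 < 1 - P by lra.
have rN : 1 - P != 0 by rewrite gt_eqF.
have step : expR (- (P / (1 - P))) <= 1 - P.
  rewrite expRN -[leRHS]invrK lef_pV2 ?posrE ?expR_gt0 ?invr_gt0 //.
  apply: le_trans (expR_ge1Dx _); rewrite le_eqVlt; apply/orP; left.
  by apply/eqP; field.
apply: le_trans (_ : n%:R * (1 - P) ^+ N <= _); last first.
  apply: ler_wpM2l => //; case: (N) => [|k]; first by rewrite expr0.
  by rewrite exprS ler_piMl ?exprn_ge0 //; lra.
apply: le_trans (_ : expR L * expR (- (P / (1 - P))) ^+ N <= _); last first.
  rewrite -nE ler_wpM2l // lerXn2r ?nnegrE ?expR_ge0 //; lra.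
rewrite -expRM_natl -expRD; apply: le_trans (expR_ge1Dx _).
have -> : N%:R * - (P / (1 - P)) = - (N%:R * P) - N%:R * P * P / (1 - P) by field.
have NPP : N%:R * P * P / (1 - P) <= 8.
  rewrite ler_pdivrMr //.
  have : N%:R * P * P <= L * P by rewrite ler_wpM2r //; lra.
  lra.
lra.
Qed.

(** * Passage to the limit *)

Section Limits.
Variable R : realType.
Implicit Types u : nat -> R.

(** This turns the Landau hypotheses, and the conclusion of the converse, into eventual bounds by a
    constant. *)
Lemma limn_einf_gt0P u : (0 < limn_einf (fun n => (u n)%:E))%E <->
  exists2 c : R, 0 < c & \forall n \near \oo, c <= u n.
Proof.
rewrite limn_einf_lim (cvg_lim _ (@cvg_einfs_sup _ _)) //; split.
  move=> /ereal_sup_gt[_ [n _ <-]]; rewrite /einfs /=.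
  have infle k : (n <= k)%N -> (ereal_inf (sdrop (fun n => (u n)%:E) n) <= (u k)%:E)%E.
    by move=> nk; apply: ereal_inf_lbound; exists k.
  case: ereal_inf infle => [r| |] infle // r0.
    exists r; first by rewrite -lte_fin.
    by exists n => // k /= nk; rewrite -lee_fin; apply: infle.
  by have := infle n (leqnn n).
move=> [c c0 [n _ Hn]]; apply: lt_le_trans (_ : c%:E <= _)%E; first by rewrite lte_fin.
apply: le_trans (_ : einfs (fun n => (u n)%:E) n <= _)%E.
  by apply: le_ereal_inf_tmp => _ [k /= nk <-]; rewrite lee_fin; apply: Hn.
by apply: ereal_sup_ubound; exists n.
Qed.

Lemma near_ln_nat_ge (A : R) : \forall n \near \oo, A <= ln (n%:R : R).
Proof.
near=> n.
have h : expR A <= n%:R by near: n; exact: nbhs_infty_ger.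
have n0 : 0 < n%:R :> R by apply: lt_le_trans h; exact: expR_gt0.
by rewrite -ler_expR lnK.
Unshelve. all: by end_near.
Qed.

(** For total mass 1 the covariance of the two indicators is the determinant of [q], and the
    denominator of the correlation is positive. *)
Lemma positively_correlated_lt (q : bool -> bool -> R) :
  prob_vector q -> positively_correlated q ->
  q true false * q false true < q true true * q false false.
Proof.
move=> [_ q1] [v1 v2]; rewrite /correlation pmulr_lgt0; last first.
  by rewrite invr_gt0 mulr_gt0 // sqrtr_gt0.
rewrite /cov2 /expect2 /fst_ind /snd_ind !big_boolE /= => cov.
have q00E : q false false = 1 - q true true - q true false - q false true.
  by move: q1; rewrite !big_boolE => <-; ring.
by rewrite q00E; lra.
Qed.

Lemma card_nonseeds (n m : nat) (V : {set 'I_(n + m)}) : #|V| = m -> #|~: V| = n.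
Proof. by move=> Vm; rewrite cardsCs finset.setCK card_ord Vm addnK. Qed.

Lemma error_prob_ge0 N (q : bool -> bool -> R) (V : {set 'I_N}) (h : estimator N) :
  (forall x y, 0 <= q x y) -> 0 <= error_prob q V h.
Proof. by move=> q0; apply: sumr_ge0 => w _; apply: mass_ge0. Qed.

End Limits.

Theorem corollary2 (R : realType) (m : nat -> nat)
    (Vs : forall n : nat, {set 'I_(n + m n)})
    (q : nat -> bool -> bool -> R) (p s : nat -> R)
    (card_seeds : forall n, #|Vs n| = m n)
    (q_prob : forall n, prob_vector (q n))
    (q_corr : forall n, positively_correlated (q n))
    (p_range : forall n, 0 <= p n <= 1)
    (s_range : forall n, 0 <= s n <= 1)
    (q11 : forall n, q n true true = p n * s n ^+ 2)
    (q10 : forall n, q n true false = p n * s n * (1 - s n))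
    (q01 : forall n, q n false true = p n * s n * (1 - s n))
    (q00 : forall n, q n false false = 1 - 2 * p n * s n + p n * s n ^+ 2)
    (p_Theta : isBigTheta (fun n => 1 - p n) (fun=> 1))
    (s_Omega : isBigOmega s (fun n => ln (n%:R : R) ^+ 2 / Num.sqrt n%:R)) :
  ((fun n => (n + m n)%:R * q n true true - ln (n%:R : R)) @ \oo --> +oo ->
    forall h : forall n, estimator (n + m n),
      (forall n, is_MAP (q n) (Vs n) (h n)) ->
      (fun n => error_prob (q n) (Vs n) (h n)) @ \oo --> (0 : R))
  /\
  ((fun n => ln (n%:R : R) - (n + m n)%:R * q n true true) @ \oo --> +oo ->
    forall h : forall n, estimator (n + m n),
      (0 < limn_einf (fun n => (error_prob (q n) (Vs n) (h n))%:E))%E).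
Proof.
have q0 k x y : 0 <= q k x y by case: (q_prob k) => q0 _; apply: q0.
have q1 k : \sum_x \sum_y q k x y = 1 by case: (q_prob k).
have qq k := positively_correlated_lt (q_prob k) (q_corr k).
have qpos k : 0 < q k true true * q k false false.
  by apply: le_lt_trans (qq k); rewrite mulr_ge0.
have q11_gt0 k : 0 < q k true true.
  rewrite lt_neqAle q0 andbT eq_sym; apply: contraTneq (qpos k) => ->.
  by rewrite mul0r ltxx.
have q00_gt0 k : 0 < q k false false.
  rewrite lt_neqAle q0 andbT eq_sym; apply: contraTneq (qpos k) => ->.
  by rewrite mulr0 ltxx.
have cardU k : #|~: Vs k| = k by apply: card_nonseeds.
split=> [gap h hM|gap h].
- have [c1 c1_gt0 near1] := (limn_einf_gt0P _).1 p_Theta.2.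
  have [c2 c2_gt0 near2] := (limn_einf_gt0P _).1 s_Omega.
  (* A single constant serves both asymptotic hypotheses, capped at 1 as [achievability_le]
     requires. *)
  pose c := Num.min 1 (Num.min c1 c2).
  have c_gt0 : 0 < c by rewrite /c !lt_min ltr01 c1_gt0 c2_gt0.
  have c_le1 : c <= 1 by rewrite /c ge_min lexx.
  have c_c1 : c <= c1 by rewrite /c !ge_min lexx !orbT.
  have c_c2 : c <= c2 by rewrite /c !ge_min lexx !orbT.
  have [L0 [B bound]] := achievability_le c_gt0 c_le1.
  apply/cvgr0Pnorm_le => eps eps0; near=> n.
  rewrite ger0_norm ?error_prob_ge0 //.
  (* The first bound makes [achievability_le] applicable; the second gives the exponential term at
     most [eps / 2], and [6 / eps <= n] does the same for [3 / n]. *)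
  have gapn : Num.max (B + 1) (B - ln (eps / 4)) <=
      (n + m n)%:R * q n true true - ln (n%:R : R).
    by near: n; move/cvgryPge: gap; apply.
  have Ln : Num.max 1 L0 <= ln (n%:R : R) by near: n; apply: near_ln_nat_ge.
  have n_ge : 6 / eps <= n%:R by near: n; apply: nbhs_infty_ger.
  have near1n : c1 <= `|1 - p n| / 1 by near: n.
  have near2n : c2 <= `|s n| / (ln (n%:R : R) ^+ 2 / Num.sqrt n%:R) by near: n.
  move: gapn; rewrite ge_max => /andP[gap1 gap2].
  move: Ln; rewrite ge_max => /andP[Ln1 LnL0].
  have n0 : 0 < n%:R :> R by apply: lt_le_trans n_ge; rewrite divr_gt0.
  have /andP[p0 p1] := p_range n; have /andP[s0 s1] := s_range n.
  apply: le_trans (MAP_error_le (q0 n) (qq n) (hM n)) _.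
  have cp : c <= 1 - p n.
    by apply: le_trans c_c1 (le_trans near1n _); rewrite divr1 ger0_norm // subr_ge0.
  have L_gt0 : 0 < ln (n%:R : R) by lra.
  have cs : c ^+ 2 * ln (n%:R : R) ^+ 4 <= n%:R * s n ^+ 2.
    have sn_gt0 : 0 < Num.sqrt (n%:R : R) by rewrite sqrtr_gt0.
    have : c * ln (n%:R : R) ^+ 2 <= s n * Num.sqrt n%:R.
      rewrite -ler_pdivrMr // -mulrA -ler_pdivlMr ?divr_gt0 ?exprn_gt0 //.
      by apply: le_trans c_c2 (le_trans near2n _); rewrite ger0_norm.
    move=> le; have : (c * ln (n%:R : R) ^+ 2) ^+ 2 <= (s n * Num.sqrt n%:R) ^+ 2.
      by apply: lerXn2r le; rewrite nnegrE mulr_ge0 ?exprn_ge0 // ltW.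
    rewrite [leRHS]exprMn sqr_sqrtr ?(ltW n0) //; lra.
  have := bound _ (q n) (~: Vs n) (p n) (s n) (q_prob n) (q11_gt0 n) (q00_gt0 n)
    (q11 n) (q10 n) (q01 n) (q00 n) p0 cp s0 s1.
  rewrite cardU => /(_ LnL0 cs gap1) /le_trans; apply.
  have e1 : expR (B - ((n + m n)%:R * q n true true - ln (n%:R : R))) <= eps / 4.
    rewrite -[leRHS]lnK ?posrE ?divr_gt0 // ler_expR; lra.
  have e2 : 3 / n%:R <= eps / 2.
    rewrite ler_pdivrMr //; move: n_ge; rewrite ler_pdivrMr //; lra.
  lra.
(* An isolated pair exists with probability at least 1/2, and the error probability is at least half
   of that. *)
- apply/limn_einf_gt0P; exists (1 / 4) => //; near=> n.
  have gapn : 17 <= ln (n%:R : R) - (n + m n)%:R * q n true true.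
    by near: n; move/cvgryPge: gap; apply.
  have Ln : 40 <= ln (n%:R : R) by near: n; apply: near_ln_nat_ge.
  have [P10 mu] := isolated_mean_ge (leq_addr (m n) n) (q0 n true true) Ln gapn.
  rewrite -[X in X%:R * _](cardU n) in mu.
  have := isolated_pair_prob (q0 n) (q1 n) mu P10.
  have := isolated_pair_le_error (Vs n) (q0 n) (h n) (ltW (qq n)).
  lra.
Unshelve. all: by end_near.
Qed.
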